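(* Let $G$ be a genogram and let $k\ge|G|$ be an integer. For any $f\in\mathcal C^{k-1}(\mathbb R)$ for which the displayed expectations are finite, $$\mathcal T_f(G)=\sum_{\substack{H\supseteq G:\ |H|\le k,\\ s_{|G|+1}\ge0}}a_{H,G}\,\mathcal S(H)\,\mathbb E\bigl[\partial^{|H|-1}f(W)\bigr]+\sum_{\substack{H\in\mathcal G(k+1):\ H\supseteq G,\\ s_{|G|+1}\ge0}}b_{H,G}\,\mathcal U_f(H),$$ where $s_{|G|+1}$ denotes the identifier of the vertex $v[|G|+1]$ of $H$ (in the first sum this condition is vacuous when $H=G$), and the coefficients are $$a_{H,G}:=\begin{cases}1&\text{if }|H|=|G|,\\(-1)^{\gamma_H-\gamma_G+\tau_H-\tau_G}\prod_{j=|G|+1}^{|H|}\frac1{j+1-u(j,H)}&\text{if }|H|\ge|G|+1,\end{cases}$$ $$b_{H,G}:=\begin{cases}(-1)^{\gamma_H-\gamma_G+\tau_H-\tau_G+1}&\text{if }|H|=|G|+1,\\(-1)^{\gamma_H-\gamma_G+\tau_H-\tau_G+1}\prod_{j=|G|+1}^{|H|-1}\frac1{j+1-u(j,H)}&\text{if }|H|\ge|G|+2.\end{cases}$$ Here $\gamma_G$ is the number of leaves of $G$ and $\tau_G$ is the number of vertices of $G$ with identifier $-1$.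
   Context: Probabilistic data. $T\subset\mathbb Z^d$ is finite and nonempty, $(X_i)_{i\in T}$ are real random variables with $\sigma^2:=\operatorname{Var}(\sum_{i\in T}X_i)>0$, $W:=\sigma^{-1}\sum_{i\in T}X_i$, and $W(J):=\sigma^{-1}\sum_{i\in T\setminus J}X_i$ for $J\subseteq T$. Fix a positive integer $m$ and a strict total order $\prec$ on $\mathbb Z^d$; $\|\cdot\|$ is the maximum norm. $\partial$ is differentiation. All identities are understood whenever the displayed expectations are finite. Genograms. An order-$k$ genogram $G=(V,E,(s_v)_{v\in V})$ is a rooted tree $(V,E)$ with $|G|:=|V|=k$ vertices and integer identifiers $s_v$ such that: (i) $s_v=0$ for the root and $s_v\ge-1$ for every other vertex; (ii) $s_v\ge0$ if $v$ is a child of the root; (iii) if a vertex has more than one child, the identifiers of its children are nonnegative and mutually different. Each genogram carries its unique compatible labeling $V=\{v[1],\dots,v[k]\}$: $v[1]$ is the root; for $1\le j\le k-1$, $v[j+1]$ is a child of the vertex with the largest label $\ell\le j$ having an as-yet unlabeled child; among siblings, a larger identifier gets a smaller label. Write $s_j$ for the identifier of $v[j]$. Two genograms are identified if their labeled trees and identifiers coincide; $\mathcal G(k)$ is the set of order-$k$ genograms. For $2\le j\le k$, $p(j)=p(j,G)$ is the label of the parent of $v[j]$; $A(j)=A(j,G)$ is the set of labels of the ancestors of $v[j]$ (excluding $j$; $A(1)=\varnothing$). Put $g(j)=g(j,G):=\sup\{\ell:\ell=1\text{ or }(\ell\in A(j)\text{ and }s_\ell\ge1)\}$ and $u(j)=u(j,G):=\sup\{\ell\in\{j\}\cup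 A(j):s_\ell\ge0\}$. For $1\le j\le k$, $G[j]$ is the order-$j$ genogram induced on $v[1],\dots,v[j]$ with identifiers $s_1,\dots,s_j$. $H\supseteq G$ means $G=H[|G|]$. A leaf is a vertex with no children. Constraint sets. For nonempty $J\subseteq T$ let $d(i,J):=\min_{j\in J}\|i-j\|$, $N(J):=\{i\in T:d(i,J)\le m\}$. Order the elements of $T\setminus N(J)$ increasingly first by $d(i,J)$ and then, for equal distance, by $\prec$; $\operatorname{rk}(i,J)\in\{1,\dots,|T\setminus N(J)|\}$ is the position of $i$ in this ordering. For $s\ge0$, $N^{(s)}(J):=N(J)\cup\{i\in T\setminus N(J):\operatorname{rk}(i,J)\le s\}$. Given $G$, put $B_1:=T$, $D_1:=\varnothing$, and recursively, for $2\le j\le k$ and given $i_1\in B_1\setminus D_1,\dots,i_{j-1}\in B_{j-1}\setminus D_{j-1}$, $B_j:=N^{(s_j)}(\{i_\ell:\ell\in A(j)\})\cup D_{g(j)}$ if $s_j\ge0$, and $B_j:=B_{u(j)}$ if $s_j=-1$; $D_j:=N^{(s_j-1)}(\{i_\ell:\ell\in A(j)\})\cup D_{g(j)}$ if $s_j\ge1$, and $D_j:=D_{g(j)}$ if $s_j\le0$. Operators. For random variables, $\mathcal D^*(Y):=\mathbb E[Y]$, $\mathcal D(Y):=Y-\mathbb E[Y]$, and for $t\ge2$, $\mathcal D^*(Y_1,\dots,Y_t):=\mathbb E[Y_1\mathcal D(Y_2,\dots,Y_t)]$, $\mathcal D(Y_1,\dots,Y_t):=Y_1\mathcal D(Y_2,\dots,Y_t)-\mathbb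 E[Y_1\mathcal D(Y_2,\dots,Y_t)]$. For an order-$k$ genogram $G$, define $\mathcal E_G(Y_1,\dots,Y_k)$ recursively: if $k=1$, $\mathcal E_G(Y):=\mathbb E[Y]$. In general let $q_0:=\sup\{j:j=1\text{ or }(2\le j\le k\text{ and }p(j)\ne j-1)\}$ and let $q_1<\dots<q_w$ be the elements of $\{t:q_0+1\le t\le k,\ s_t\ge0\}$ (possibly $w=0$). Let $\mathcal D^*_{\mathrm{last}}:=\mathcal D^*(Y_{q_0}\cdots Y_{q_1-1},\,Y_{q_1}\cdots Y_{q_2-1},\,\dots,\,Y_{q_w}\cdots Y_k)$, read as $\mathcal D^*(Y_{q_0}\cdots Y_k)$ when $w=0$. Then $\mathcal E_G(Y_1,\dots,Y_k):=\mathcal D^*_{\mathrm{last}}$ if $q_0=1$, and $:=\mathcal E_{G[q_0-1]}(Y_1,\dots,Y_{q_0-1})\cdot\mathcal D^*_{\mathrm{last}}$ if $q_0\ge2$. Sums. For $G\in\mathcal G(k)$ and $f\in\mathcal C^{k-1}(\mathbb R)$ (for $\mathcal U_f$ and $\Delta_f$: $k\ge2$, and only $f\in\mathcal C^{k-2}(\mathbb R)$ is used), $\mathcal S(G):=\sigma^{-k}\sum_{i_1\in B_1\setminus D_1}\cdots\sum_{i_k\in B_k\setminus D_k}\mathcal E_G(X_{i_1},\dots,X_{i_k})$; $\mathcal T_f(G):=\sigma^{-k}\sum_{i_1\in B_1\setminus D_1}\cdots\sum_{i_k\in B_k\setminus D_k}\mathcal E_G(X_{i_1},\dots,X_{i_{k-1}},X_{i_k}\,\partial^{k-1}f(W(D_k)))$;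 $\mathcal U_f(G):=\sigma^{-(k-1)}\sum_{i_1\in B_1\setminus D_1}\cdots\sum_{i_{k-1}\in B_{k-1}\setminus D_{k-1}}\mathcal E_G(X_{i_1},\dots,X_{i_{k-1}},\Delta_f(G))$, where $\Delta_f(G):=\partial^{k-2}f(W(B_k))-\partial^{k-2}f(W(D_k))$ if $u(k)=k$, and $\Delta_f(G):=\int_0^1(k-u(k))v^{k-1-u(k)}\bigl(\partial^{k-2}f(vW(D_k)+(1-v)W(B_k))-\partial^{k-2}f(W(D_k))\bigr)\,dv$ if $u(k)\le k-1$. Since $T$ is finite, only finitely many terms in the sums over genograms are nonzero. *)

(* Defs.v *)
From HB Require Import structures.
From mathcomp Require Import all_boot all_order all_algebra.
From mathcomp Require Import finmap.
From mathcomp Require Import all_classical all_reals all_analysis.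

Set Implicit Arguments.
Unset Strict Implicit.
Unset Printing Implicit Defensive.

Import Order.TTheory GRing.Theory Num.Theory.
Import numFieldNormedType.Exports.

Local Open Scope classical_set_scope.
Local Open Scope ring_scope.

(* A genogram of order k is stored through its compatible labeling: it is the
   sequence of the pairs (p(j), s_j) for j = 1, ..., k, where p(j) is the label
   of the parent of v[j] and s_j the identifier of v[j].  Labels start at 1;
   the root has the dummy parent label 0.  Equality of such sequences is the
   identification of genograms with the same labeled tree and identifiers. *)
Definition pregenogram := seq (nat * int).

Section Labels.
Context (G : pregenogram).

Definition par (j : nat) : nat := (nth (0%N, 0 : int) G j.-1).1.

Definition sid (j : nat) : int := (nth (0%N, 0 : int) G j.-1).2.

Definition labels : seq nat := iota 1 (size G).

Definition nonroots : seq nat := iota 2 (size G).-1.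

Definition root_ok : bool :=
  [&& (0 < size G)%N, par 1 == 0%N & sid 1 == 0].

(* As p(j) < j, every vertex has the root as an ancestor. *)
Definition tree_ok : bool :=
  all (fun j => [&& (0 < par j)%N, (par j < j)%N & -1 <= sid j]) nonroots.

Definition root_children_ok : bool :=
  all (fun j => (par j == 1%N) ==> (0 <= sid j)) nonroots.

Definition siblings_ok : bool :=
  all (fun i => all (fun j => ((i != j) && (par i == par j)) ==>
    [&& 0 <= sid i, 0 <= sid j & sid i != sid j]) nonroots) nonroots.

(* When v[1], ..., v[j] have been labeled, the vertices having an as-yet
   unlabeled child are the p(c) with c > j; p(j+1) is the largest of those with
   label at most j. *)
Definition labeling_ok : bool :=
  all (fun j => all (fun c => ((j < c)%N && (par c <= j)%N) ==>
    (par c <= par j.+1)%N) nonroots) labels.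

Definition sibling_order_ok : bool :=
  all (fun i => all (fun j => ((i < j)%N && (par i == par j)) ==>
    (sid j < sid i)) nonroots) nonroots.

Definition is_genogram : bool :=
  [&& root_ok, tree_ok, root_children_ok, siblings_ok, labeling_ok
    & sibling_order_ok].

(* A(j), from the parent of v[j] up to the root; the filter removes the dummy
   label 0. *)
Definition anc (j : nat) : seq nat :=
  [seq l <- traject par (par j) j | (0 < l)%N].

Definition gidx (j : nat) : nat :=
  maxn 1 (\max_(l <- anc j | 1 <= sid l) l).

Definition uidx (j : nat) : nat :=
  \max_(l <- j :: anc j | 0 <= sid l) l.

Definition leaves : nat :=
  count (fun l => ~~ has (fun c => par c == l) nonroots) labels.

Definition minus_ones : nat := count (fun l => sid l == -1) labels.

Definition q0 : nat :=
  maxn 1 (\max_(j <- nonroots | par j != j.-1) j).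

Definition qs : seq nat :=
  [seq t <- iota q0.+1 (size G - q0) | 0 <= sid t].

End Labels.

Record genogram := Genogram {
  gseq :> seq (nat * int);
  gseqP : is_genogram gseq
}.

HB.instance Definition _ := [isSub for gseq].
HB.instance Definition _ := [Choice of genogram by <:].

Definition gorder (G : genogram) : nat := size (gseq G).

(* H \supseteq G, i.e. G = H[|G|]. *)
Definition gextends (H G : genogram) : Prop :=
  gseq G = take (gorder G) (gseq H).

Section ConstraintSets.
Context (d : nat).
Local Notation point := 'rV[int]_d.

Definition pdist (i j : point) : nat :=
  \max_(l < d) absz (i ord0 l - j ord0 l).

(* The distance to a nonempty J; the start value of the minimum is the distance
   to an element of J. *)
Definition setdist (i : point) (J : {fset point}) : nat :=
  \big[minn/pdist i (head i J)]_(j <- J) pdist i j.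

Context (T : {fset point}) (m : nat) (prec : rel point).

Definition nbh (J : {fset point}) : {fset point} :=
  [fset i in T | (setdist i J <= m)%N]%fset.

Definition dist_prec_le (J : {fset point}) : rel point := fun i j =>
  (setdist i J < setdist j J)%N ||
  ((setdist i J == setdist j J) && ((i == j) || prec i j)).

Definition rk (i : point) (J : {fset point}) : nat :=
  (index i (sort (dist_prec_le J) (T `\` nbh J)%fset)).+1.

Definition nbh_ext (s : nat) (J : {fset point}) : {fset point} :=
  (nbh J `|` [fset i in T `\` nbh J | (rk i J <= s)%N])%fset.

Section BD.
(* [ii] is the sequence i_1, i_2, ... of summation indices. *)
Context (G : pregenogram) (ii : seq point).

Definition pt (l : nat) : point := nth 0 ii l.-1.

Definition anc_pts (j : nat) : {fset point} :=
  [fset x in [seq pt l | l <- anc G j]]%fset.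

(* [prev] is the list of the pairs (B_l, D_l), 1 <= l < j. *)
Definition BD_step (prev : seq ({fset point} * {fset point})) (j : nat) :
    {fset point} * {fset point} :=
  let Bp l := (nth (fset0, fset0) prev l.-1).1 in
  let Dp l := (nth (fset0, fset0) prev l.-1).2 in
  if (j <= 1)%N then (T, fset0) else
  ((if 0 <= sid G j
    then nbh_ext (absz (sid G j)) (anc_pts j) `|` Dp (gidx G j)
    else Bp (uidx G j)),
   (if 1 <= sid G j
    then nbh_ext (absz (sid G j - 1)) (anc_pts j) `|` Dp (gidx G j)
    else Dp (gidx G j)))%fset.

Fixpoint BD_list (n : nat) : seq ({fset point} * {fset point}) :=
  if n is n'.+1 then rcons (BD_list n') (BD_step (BD_list n') n) else [::].

Definition Bset (j : nat) : {fset point} :=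
  (nth (fset0, fset0) (BD_list j) j.-1).1.

Definition Dset (j : nat) : {fset point} :=
  (nth (fset0, fset0) (BD_list j) j.-1).2.

Definition admissible : Prop :=
  forall j, (1 <= j <= size ii)%N -> pt j \in (Bset j `\` Dset j)%fset.

Lemma size_BD_list n : size (BD_list n) = n.
Proof. by elim: n => //= n IHn; rewrite size_rcons IHn. Qed.

Lemma nth_BD_list n l : (0 < l <= n)%N ->
  nth (fset0, fset0) (BD_list n) l.-1 = (Bset l, Dset l).
Proof.
rewrite /Bset /Dset -surjective_pairing; elim: n => [|n IHn].
  by case: l.
case/andP=> l0; rewrite leq_eqVlt => /predU1P[->//|].
rewrite ltnS => ln /=.
by rewrite nth_rcons size_BD_list prednK // ln IHn // l0.
Qed.

Lemma BD1 : Bset 1 = T /\ Dset 1 = fset0.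
Proof. by []. Qed.

End BD.

Lemma traject_par_lt G j n l : is_genogram G -> (1 < j <= size G)%N ->
  l \in traject (par G) (par G j) n -> (l < j)%N.
Proof.
case/and5P=> /and3P[G0 /eqP p1 _] /allP tok _ _ _.
have p0 : par G 0 = 0%N by rewrite -[RHS]p1.
have plt c : (1 < c <= size G)%N -> (par G c < c)%N.
  case/andP=> c1 cG; have /tok/and3P[//] : c \in nonroots G.
  by rewrite mem_iota c1 addnC addn2 prednK.
elim: n j => // n IHn j jG; rewrite /= inE => /predU1P[->|]; first exact: plt.
have := plt j jG; case E: (par G j) => [|[|c]] cj.
- move=> /trajectP[q _ ->]; suff -> : iter q (par G) (par G 0) = 0%N.
    by case/andP: jG => /ltnW.
  by elim: q => //= q ->.
- rewrite p1; move=> /trajectP[q _ ->]; suff -> : iter q (par G) 0%N = 0%N.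
    by case/andP: jG => /ltnW.
  by elim: q => //= q ->.
- move=> /IHn; have -> : (1 < c.+2 <= size G)%N.
    by rewrite /= (leq_trans (ltnW cj))//; case/andP: jG.
  by move=> /(_ isT) /ltn_trans; apply.
Qed.

Lemma gidx_lt G j : is_genogram G -> (1 < j <= size G)%N ->
  (0 < gidx G j < j)%N.
Proof.
move=> hG hj; case/andP: (hj) => j1 _; rewrite leq_max /= gtn_max j1 /=.
have j0 : (0 < j)%N by exact: ltnW.
rewrite -[X in (_ < X)%N](prednK j0) ltnS big_seq_cond; apply/bigmax_leqP_seq.
move=> l _ /andP[+ _]; rewrite mem_filter => /andP[_ lt].
by rewrite -ltnS prednK //; exact: traject_par_lt lt.
Qed.

Lemma Dset_rec G ii j : is_genogram G -> (1 < j <= size G)%N ->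
  Dset G ii j = (if 1 <= sid G j
    then nbh_ext (absz (sid G j - 1)) (anc_pts G ii j) `|` Dset G ii (gidx G j)
    else Dset G ii (gidx G j))%fset.
Proof.
move=> hG hj; have := gidx_lt hG hj; case: j hj => // j hj /andP[g0 gj].
rewrite {1}/Dset /= nth_rcons size_BD_list ltnn eqxx /BD_step.
case/andP: hj => j1 _; rewrite leqNgt j1 /= nth_BD_list // g0.
by rewrite -ltnS.
Qed.

Lemma root_anc G j : is_genogram G -> (1 < j <= size G)%N -> 1%N \in anc G j.
Proof.
move=> /and5P[/and3P[G0 _ _] /allP tok _ _ _]; rewrite mem_filter /=.
elim/ltn_ind: j => j IH /andP[j1 jG].
have /tok/and3P[p0 pj _] : j \in nonroots G.
  by rewrite mem_iota j1 addnC addn2 prednK.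
case: j j1 jG p0 pj IH => // j j1 jG p0 pj IH; rewrite [traject _ _ _]/= inE.
case: eqVneq => //= p1.
have {}p1 : (1 < par G j.+1)%N by rewrite ltn_neqAle p1.
have pG : (par G j.+1 <= size G)%N by exact: leq_trans (ltnW pj) jG.
have /trajectP[q qlt ->] := IH _ pj (introT andP (conj p1 pG)).
by apply/trajectP; exists q => //; exact: leq_trans qlt pj.
Qed.

Lemma uidx_lt G j : is_genogram G -> (1 < j <= size G)%N -> sid G j < 0 ->
  (0 < uidx G j < j)%N.
Proof.
move=> hG hj sj; have j1 := root_anc hG hj.
have s10 : 0 <= sid G 1 by case/and5P: hG => /and3P[_ _ /eqP->].
rewrite /uidx big_cons leNgt sj /=; apply/andP; split.
  exact: (@leq_bigmax_seq _ _ (fun l => 0 <= sid G l) id 1%N j1 s10).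
have j0 : (0 < j)%N by case/andP: hj => /ltnW.
rewrite -[X in (_ < X)%N](prednK j0) ltnS big_seq_cond; apply/bigmax_leqP_seq.
move=> l _ /andP[+ _]; rewrite mem_filter => /andP[_ lt].
by rewrite -ltnS prednK //; exact: traject_par_lt lt.
Qed.

Lemma Bset_rec G ii j : is_genogram G -> (1 < j <= size G)%N ->
  Bset G ii j = (if 0 <= sid G j
    then nbh_ext (absz (sid G j)) (anc_pts G ii j) `|` Dset G ii (gidx G j)
    else Bset G ii (uidx G j))%fset.
Proof.
move=> hG hj; have := gidx_lt hG hj; have := uidx_lt hG hj.
case: j hj => // j hj uj gj.
rewrite {1}/Bset [BD_list _ _ j.+1]/= nth_rcons size_BD_list ltnn eqxx /BD_step.
case/andP: hj => j1 _; rewrite leqNgt j1 [LHS]/= (nth_BD_list _ _ gj).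
case: (boolP (0 <= sid G j.+1)) => [_|]; first by [].
rewrite -ltNge => /uj ul; by rewrite (nth_BD_list _ _ ul).
Qed.

Fixpoint nested_sum (R : nmodType) (G : pregenogram) (n : nat)
    (ii : seq point) (F : seq point -> R) : R :=
  if n is n'.+1 then
    \sum_(i <- (Bset G ii (size ii).+1 `\` Dset G ii (size ii).+1)%fset)
      nested_sum G n' (rcons ii i) F
  else F ii.

End ConstraintSets.

Section Operators.
Context (R : realType) (disp : measure_display) (Omega : measurableType disp)
  (P : probability Omega R).
Local Notation rv := (Omega -> R).

Definition Ex (Y : rv) : R := fine ('E_P[Y]).

Definition finite_Ex (Y : rv) : Prop := P.-integrable setT (EFin \o Y).

Fixpoint Dop (Ys : seq rv) : rv :=
  match Ys with
  | [::] => cst 0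
  | [:: Y] => fun w => Y w - Ex Y
  | Y :: Ys' => fun w => Y w * Dop Ys' w - Ex (fun w' => Y w' * Dop Ys' w')
  end.

Definition Dstar (Ys : seq rv) : R :=
  match Ys with
  | [::] => 0
  | [:: Y] => Ex Y
  | Y :: Ys' => Ex (fun w => Y w * Dop Ys' w)
  end.

(* Finiteness of all the expectations taken in [Dstar Ys], including those in
   the nested [Dop]. *)
Fixpoint Dstar_finite (Ys : seq rv) : Prop :=
  match Ys with
  | [::] => True
  | [:: Y] => finite_Ex Y
  | Y :: Ys' => Dstar_finite Ys' /\ finite_Ex (fun w => Y w * Dop Ys' w)
  end.

(* The products Y_{q_0} ... Y_{q_1 - 1}, ..., Y_{q_w} ... Y_k. *)
Definition last_blocks (G : pregenogram) (Ys : seq rv) : seq rv :=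
  [seq (fun w => \prod_(ab.1 <= j < ab.2) nth (cst 0) Ys j.-1 w)
  | ab <- zip (q0 G :: qs G) (rcons (qs G) (size G).+1)].

(* [n] bounds the number of recursive calls. *)
Fixpoint EG_rec (n : nat) (G : pregenogram) (Ys : seq rv) : R :=
  if n is n'.+1 then
    if q0 G == 1%N then Dstar (last_blocks G Ys)
    else EG_rec n' (take (q0 G).-1 G) (take (q0 G).-1 Ys)
         * Dstar (last_blocks G Ys)
  else 0.

Definition EG (G : pregenogram) (Ys : seq rv) : R := EG_rec (size G) G Ys.

Fixpoint EG_finite_rec (n : nat) (G : pregenogram) (Ys : seq rv) : Prop :=
  if n is n'.+1 then
    (q0 G != 1%N -> EG_finite_rec n' (take (q0 G).-1 G) (take (q0 G).-1 Ys))
    /\ Dstar_finite (last_blocks G Ys)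
  else True.

Definition EG_finite (G : pregenogram) (Ys : seq rv) : Prop :=
  EG_finite_rec (size G) G Ys.

Lemma q0_bounds G : (0 < size G)%N -> (0 < q0 G <= size G)%N.
Proof.
move=> G0; rewrite leq_max /= geq_max G0 /=; apply/bigmax_leqP_seq => j.
by rewrite mem_iota addnC addn2 prednK // ltnS => /andP[].
Qed.

Lemma EG_rec_fuel n G Ys : (0 < size G <= n)%N ->
  EG_rec n G Ys = EG G Ys.
Proof.
move=> /andP[]; rewrite /EG; move En : (size G) => N.
elim/ltn_ind: N n G Ys En => -[//|N] IH [//|n] G Ys En _ Nn /=.
case: ifPn => // q1; have : (0 < q0 G <= size G)%N by rewrite q0_bounds ?En.
case/andP=> q0_gt0 qle; have q2 : (0 < (q0 G).-1)%N by case: (q0 G) q1 q0_gt0 => [|[]].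
have qs : size (take (q0 G).-1 G) = (q0 G).-1.
  by rewrite size_take_min; apply/minn_idPl; exact: leq_trans (leq_pred _) _.
have lt : ((q0 G).-1 < N.+1)%N by rewrite -En prednK.
by rewrite (IH _ lt n) // ?(IH _ lt N) //; exact: leq_trans lt Nn.
Qed.

Lemma EG_unfold G Ys : (0 < size G)%N ->
  EG G Ys = if q0 G == 1%N then Dstar (last_blocks G Ys)
            else EG (take (q0 G).-1 G) (take (q0 G).-1 Ys)
                 * Dstar (last_blocks G Ys).
Proof.
move=> G0; rewrite {1}/EG -[in LHS](prednK G0) /=; case: ifPn => // q1.
case/andP: (q0_bounds G0) => q0_gt0 qle.
have qs : size (take (q0 G).-1 G) = (q0 G).-1.
  by rewrite size_take_min; apply/minn_idPl; exact: leq_trans (leq_pred _) _.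
rewrite EG_rec_fuel // qs -!subn1 leq_sub2r // andbT subn_gt0.
by case: (q0 G) q1 q0_gt0 => [|[]].
Qed.

End Operators.

Section Sums.
Context (R : realType) (disp : measure_display) (Omega : measurableType disp)
  (P : probability Omega R) (d : nat) (T : {fset 'rV[int]_d})
  (X : 'rV[int]_d -> {RV P >-> R}) (m : nat) (prec : rel 'rV[int]_d).
Local Notation point := 'rV[int]_d.
Local Notation rv := (Omega -> R).

Definition total_variance : \bar R := 'V_P[(fun w => \sum_(i <- T) X i w)].

Definition sigma : R := Num.sqrt (fine total_variance).

Definition Wset (J : {fset point}) : rv :=
  fun w => sigma^-1 * \sum_(i <- (T `\` J)%fset) X i w.

Definition Wtot : rv := fun w => sigma^-1 * \sum_(i <- T) X i w.

Definition XS (ii : seq point) : seq rv := [seq (X i : rv) | i <- ii].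

Section Genogram.
Context (G : pregenogram).
Local Notation k := (size G).
Local Notation B := (Bset T m prec G).
Local Notation D := (Dset T m prec G).

Definition calS : R :=
  sigma ^- k * nested_sum T m prec G k [::] (fun ii => EG P G (XS ii)).

Context (f : R -> R).

Definition T_args (ii : seq point) : seq rv :=
  rcons (XS (take k.-1 ii))
    (fun w => X (pt ii k) w * derive1n k.-1 f (Wset (D ii k) w)).

Definition calT : R :=
  sigma ^- k * nested_sum T m prec G k [::] (fun ii => EG P G (T_args ii)).

Definition Delta (ii : seq point) : rv := fun w =>
  if uidx G k == k then
    derive1n k.-2 f (Wset (B ii k) w) - derive1n k.-2 f (Wset (D ii k) w)
  else
    Rintegral (@lebesgue_measure R) `[0, 1] (fun v =>
      (k - uidx G k)%:R * v ^+ (k.-1 - uidx G k)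
      * (derive1n k.-2 f (v * Wset (D ii k) w + (1 - v) * Wset (B ii k) w)
         - derive1n k.-2 f (Wset (D ii k) w))).

Definition U_args (ii : seq point) : seq rv := rcons (XS ii) (Delta ii).

Definition calU : R :=
  sigma ^- k.-1 *
  nested_sum T m prec G k.-1 [::] (fun ii => EG P G (U_args ii)).

Definition S_finite : Prop := forall ii : seq point,
  size ii = k -> admissible T m prec G ii -> EG_finite P G (XS ii).

Definition T_finite : Prop := forall ii : seq point,
  size ii = k -> admissible T m prec G ii -> EG_finite P G (T_args ii).

Definition U_finite : Prop := forall ii : seq point,
  size ii = k.-1 -> admissible T m prec G ii -> EG_finite P G (U_args ii).

End Genogram.
End Sums.

Definition class_C (R : realType) (n : nat) (f : R -> R) : Prop :=
  (forall j, (j < n)%N -> forall x, derivable (derive1n j f) x 1) /\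
  continuous (derive1n n f).

Definition sgn_exp (H G : genogram) : int :=
  (leaves H)%:Z - (leaves G)%:Z + (minus_ones H)%:Z - (minus_ones G)%:Z.

Definition coef_a (R : realType) (H G : genogram) : R :=
  if gorder H == gorder G then 1
  else (-1) ^ (sgn_exp H G) *
    \prod_((gorder G).+1 <= j < (gorder H).+1) ((j.+1 - uidx H j)%:R)^-1.

(* For |H| = |G| + 1 the product is empty. *)
Definition coef_b (R : realType) (H G : genogram) : R :=
  (-1) ^ (sgn_exp H G + 1) *
    \prod_((gorder G).+1 <= j < gorder H) ((j.+1 - uidx H j)%:R)^-1.

Definition ext_le (G : genogram) (k : nat) : set genogram :=
  [set H | [/\ gextends H G, (gorder H <= k)%N &
    (gorder G < gorder H)%N -> 0 <= sid H (gorder G).+1]].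

Definition ext_eq (G : genogram) (k : nat) : set genogram :=
  [set H | [/\ gextends H G, gorder H = k & 0 <= sid H (gorder G).+1]].

(* Main.v *)
Require Import Defs.
From mathcomp Require Import all_boot all_order all_algebra.
From mathcomp Require Import finmap.
From mathcomp Require Import all_classical all_reals all_analysis.
From mathcomp Require Import zify ring.

Set Implicit Arguments.
Unset Strict Implicit.
Unset Printing Implicit Defensive.

Import Order.TTheory GRing.Theory Num.Theory.
Import numFieldNormedType.Exports.

Local Open Scope classical_set_scope.
Local Open Scope ring_scope.

(* Two one-step expansions are iterated.

   Let n = |G| and F = f^(n-1)(W(D_n)).  Cutting the last block of the operator,
   E_G(.., X_n F) = E_G(.., X_n, F) + E_G(.., X_n) E[F].  Since the operators
   kill constants, the first term is minus the sum of the U-terms of the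
   extensions of G by a child of v[n]: their sets form a chain from D_n to T, so
   the sum over the identifier telescopes.  Likewise E[F] - E[f^(n-1)(W)] is the
   sum over the extensions by a further child of an ancestor of v[n], because
   the chain hung beside a vertex c of the branch of v[n] runs from D_{g(c)} to
   D_c, and D_{g(c)} = D_{p(c)}.  This expands T_f(G) into U-terms of order n+1.

   Conversely, integration by parts against v^(n - u(n)) in Delta_f gives
   U_f(H) = - (T_f(H) + U_f(H')) / (n + 1 - u(n)), where H' extends H by a child
   of v[n] with identifier -1.

   Finiteness of the expectations propagates in the opposite direction: that of
   the U-terms of order k+1 gives that of the T-terms of order k, which gives
   that of the U-terms of order k. *)

(** * Genograms and their one-step extensions *)

(** The coefficients are products of one-step contributions. A child of v[n] replaces v[n] as a
    leaf, so the number of leaves is unchanged; a further child of an earlier branch vertex adds one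
    leaf; an identifier -1 adds one to the count of such vertices. With the extra 1 in the exponent
    of b, the three kinds of extension get the signs -1, 1 and 1, which are those of their U-terms.
    Each use of integration by parts at order j multiplies by -1/(j+1-u(j)), and this turns b into
    a. Integration by parts gains an index i_n because W(D_n) - W(B_n) is a normalized sum over B_n
    \ D_n. The remaining integral must then not depend on i_n. This is why the new vertex has
    identifier -1: it inherits both of its sets from v[n], and its argument is multiplied with
    X_(i_n) inside one block. Identifiers are unbounded, so the sums range over infinitely many
    genograms. As soon as an identifier exceeds |T|, the sets B and D of its vertex agree and the
    term vanishes. The iteration therefore runs over finite lists of raw sequences, and the passage
    to sums over sets of genograms is made only at the end. *)

Lemma mem_nonroots G j : (0 < size G)%N ->
  (j \in nonroots G) = (1 < j <= size G)%N.
Proof. by move=> G0; rewrite mem_iota addnC addn2 prednK. Qed.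

Lemma mem_labels G j : (j \in labels G) = (0 < j <= size G)%N.
Proof. by rewrite mem_iota addnC addn1. Qed.

Record genogram_spec (G : pregenogram) : Prop := GenogramSpec {
  gs_size : (0 < size G)%N;
  gs_par1 : par G 1 = 0%N;
  gs_sid1 : sid G 1 = 0;
  gs_tree : forall j, (1 < j <= size G)%N ->
    [/\ (0 < par G j)%N, (par G j < j)%N & -1 <= sid G j];
  gs_root : forall j, (1 < j <= size G)%N -> par G j = 1%N -> 0 <= sid G j;
  gs_sib : forall i j, (1 < i)%N -> (i < j)%N -> (j <= size G)%N ->
    par G i = par G j -> 0 <= sid G j < sid G i;
  gs_label : forall j c, (0 < j)%N -> (j < c)%N -> (c <= size G)%N ->
    (par G c <= j)%N -> (par G c <= par G j.+1)%N
}.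

Lemma genogramP G : reflect (genogram_spec G) (is_genogram G).
Proof.
apply: (iffP idP).
  case/and5P=> /and3P[G0 /eqP p1 /eqP s1] /allP tok /allP rok /allP sok
    /andP[/allP lok /allP ook].
  split=> //.
  - by move=> j; rewrite -mem_nonroots// => /tok/and3P[].
  - by move=> j; rewrite -mem_nonroots// => /rok/implyP h /eqP; exact: h.
  - move=> i j i1 ij jG pij.
    have iG : i \in nonroots G by rewrite mem_nonroots//; lia.
    have {}jG : j \in nonroots G by rewrite mem_nonroots//; lia.
    have /allP/(_ _ jG)/implyP := ook _ iG.
    rewrite ij pij eqxx => /(_ isT) ->.
    have /allP/(_ _ jG)/implyP := sok _ iG.
    by rewrite pij eqxx andbT neq_ltn ij => /(_ isT)/and3P[_ ->].
  - move=> j c j0 jc cG pc.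
    have jG : j \in labels G by rewrite mem_labels; lia.
    have {}cG : c \in nonroots G by rewrite mem_nonroots//; lia.
    by have /allP/(_ _ cG)/implyP := lok _ jG; apply; rewrite jc.
case=> G0 p1 s1 tok rok sok lok.
apply/and5P; split; first by rewrite /root_ok G0 p1 s1.
- by apply/allP => j; rewrite mem_nonroots// => /tok[-> -> ->].
- apply/allP => j; rewrite mem_nonroots// => jG.
  by apply/implyP => /eqP; exact: rok.
- apply/allP => i; rewrite mem_nonroots// => /andP[i1 iG].
  apply/allP => j; rewrite mem_nonroots// => /andP[j1 jG].
  apply/implyP => /andP[+ /eqP pij]; rewrite neq_ltn => /orP[] ij.
    by have /andP[? ?] := sok _ _ i1 ij jG pij; apply/and3P; split; lia.
  by have /andP[? ?] := sok _ _ j1 ij iG (esym pij); apply/and3P; split; lia.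
apply/andP; split.
  apply/allP => j; rewrite mem_labels => /andP[j0 jG].
  apply/allP => c; rewrite mem_nonroots// => /andP[c1 cG].
  by apply/implyP => /andP[jc pc]; exact: lok.
apply/allP => i; rewrite mem_nonroots// => /andP[i1 iG].
apply/allP => j; rewrite mem_nonroots// => /andP[j1 jG].
by apply/implyP => /andP[ij /eqP pij]; have /andP[] := sok _ _ i1 ij jG pij.
Qed.

Section Rcons.
Context (G : pregenogram) (p : nat) (s : int).
Let G' : pregenogram := rcons G (p, s).

Lemma par_rcons_lt j : (0 < size G)%N -> (j <= size G)%N -> par G' j = par G j.
Proof. by move=> G0 jG; rewrite /par nth_rcons ifT//; case: j jG. Qed.

Lemma sid_rcons_lt j : (0 < size G)%N -> (j <= size G)%N -> sid G' j = sid G j.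
Proof. by move=> G0 jG; rewrite /sid nth_rcons ifT//; case: j jG. Qed.

Lemma par_rcons_last : par G' (size G).+1 = p.
Proof. by rewrite /par nth_rcons ltnn eqxx. Qed.

Lemma sid_rcons_last : sid G' (size G).+1 = s.
Proof. by rewrite /sid nth_rcons ltnn eqxx. Qed.

End Rcons.

Lemma par0 G : par G 0 = par G 1. Proof. by []. Qed.

Lemma par_le G j : genogram_spec G -> (j <= size G)%N -> (par G j <= j.-1)%N.
Proof.
move=> hG; case: j => [|[|j]] jG; first by rewrite par0 (gs_par1 hG).
  by rewrite (gs_par1 hG).
by have [] := gs_tree hG (j := j.+2) jG.
Qed.

(** The parent map lowers positive labels and fixes 0, so [x] iterations reach the dummy label,
    which the filter discards. Hence the length of the trajectory in [anc] is immaterial, and [anc]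
    obeys a recursion along parents. *)
Lemma traject_par_fuel G n n' x : genogram_spec G -> (x <= size G)%N ->
  (x <= n)%N -> (x <= n')%N ->
  [seq l <- traject (par G) x n | (0 < l)%N] =
  [seq l <- traject (par G) x n' | (0 < l)%N].
Proof.
move=> hG.
have z r : [seq l <- traject (par G) 0 r | (0 < l)%N] = [::].
  by elim: r => //= r IH; rewrite par0 (gs_par1 hG).
elim/ltn_ind: x n n' => -[|x] IH n n' xG; first by rewrite !z.
case: n => // n; case: n' => // n' xn xn' /=.
congr (_ :: _); have := par_le hG xG; rewrite /= => px.
by apply: IH => //; apply: leq_trans px _ => //; apply: ltnW.
Qed.

Lemma anc_rec G j : genogram_spec G -> (1 < j <= size G)%N ->
  anc G j = par G j :: anc G (par G j).
Proof.
move=> hG jG; have [p0 pj _] := gs_tree hG jG.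
rewrite /anc; case: j jG p0 pj => // j jG p0 pj; rewrite [traject _ _ _]/= /= p0.
congr (_ :: _); apply: traject_par_fuel => //.
- by apply: leq_trans (par_le hG _) _; lia.
- by apply: leq_trans (par_le hG _) _; lia.
- by apply: leq_trans (par_le hG _) _; lia.
Qed.

Lemma anc1 G : genogram_spec G -> anc G 1 = [::].
Proof. by move=> hG; rewrite /anc /= (gs_par1 hG). Qed.

Lemma anc_lt G j l : genogram_spec G -> (0 < j <= size G)%N -> l \in anc G j ->
  (0 < l < j)%N.
Proof.
move=> hG; elim/ltn_ind: j => -[//|[|j]] IH jG; first by rewrite anc1.
have [p0 pj _] := gs_tree hG (j := j.+2) jG.
rewrite anc_rec// inE => /predU1P[->|]; first by rewrite p0.
by move/(IH _ pj); lia.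
Qed.

(* This expresses that the labeling is depth-first. *)
Lemma par_ge_chain G e c : genogram_spec G -> (0 < e <= size G)%N ->
  c \in e :: anc G e -> forall j, (c < j <= e)%N -> (c <= par G j)%N.
Proof.
move=> hG; elim/ltn_ind: e c => e IH c eG; rewrite inE => /predU1P[->|]; first lia.
case: e IH eG => [|[|e]] IH eG //; first by rewrite anc1.
have [p0 pj _] := gs_tree hG (j := e.+2) eG.
move=> cA j /andP[cj je].
have cp : (c <= par G e.+2)%N.
  move: cA; rewrite anc_rec// inE => /predU1P[->//|].
  by move/(anc_lt hG); lia.
have [jp|pj'] := leqP j (par G e.+2).
  by apply: (IH _ pj) => //; [lia|move: cA; rewrite anc_rec//|rewrite cj].
apply: leq_trans cp _.
have := gs_label hG (j := j.-1) (c := e.+2).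
by rewrite (ltn_predK cj); apply; lia.
Qed.

Lemma sub_anc G c l : genogram_spec G -> (0 < c <= size G)%N ->
  l \in c :: anc G c -> {subset l :: anc G l <= c :: anc G c}.
Proof.
move=> hG; elim/ltn_ind: c l => c IH l cG; rewrite inE => /predU1P[->//|].
case: c IH cG => [|[|c]] IH cG //; first by rewrite anc1.
have [p0 pj _] := gs_tree hG (j := c.+2) cG.
rewrite anc_rec// => lp x xl; rewrite inE; apply/orP; right.
by apply: (IH _ pj) lp _ xl; lia.
Qed.

Lemma chain_uniq G c : genogram_spec G -> (0 < c <= size G)%N ->
  uniq (c :: anc G c).
Proof.
move=> hG; elim/ltn_ind: c => c IH cG.
case: c IH cG => [|[|c]] IH cG //; first by rewrite anc1.
have [p0 pj _] := gs_tree hG (j := c.+2) cG.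
rewrite cons_uniq; apply/andP; split; first by apply/negP => /(anc_lt hG cG); lia.
by rewrite anc_rec//; apply: IH => //; lia.
Qed.

(** For branch vertices [c < c'], depth-first labeling gives p(c') >= c > p(c). This makes the
    description of a branch extension by [c] unambiguous. *)
Lemma par_inj_chain G e c c' : genogram_spec G -> (0 < e <= size G)%N ->
  c \in e :: anc G e -> c' \in e :: anc G e -> (1 < c)%N -> (1 < c')%N ->
  par G c = par G c' -> c = c'.
Proof.
move=> hG eG.
have le x : x \in e :: anc G e -> (x <= e)%N.
  by rewrite inE => /predU1P[->//|/(anc_lt hG eG)]; lia.
wlog cc : c c' / (c <= c')%N.
  move=> h ce ce' c1 c1' E; have [|/ltnW] := leqP c c' => cc; first exact: h.
  by symmetry; apply: h.
move=> ce ce' c1 c1' E; apply/eqP; rewrite eqn_leq cc /= leqNgt; apply/negP => lt.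
have := par_ge_chain hG eG ce (j := c').
have [_ ? _] : [/\ (0 < par G c)%N, (par G c < c)%N & -1 <= sid G c].
  by apply: gs_tree => //; have := le _ ce; lia.
have := le _ ce'; rewrite -E; lia.
Qed.

(* A one-step extension of a genogram of order [n] is encoded by the pair
   [(p(n+1), s_(n+1))]. *)
Definition top_ext (M : nat) (G : pregenogram) : seq (nat * int) :=
  [seq (size G, s%:Z) | s <- iota 0 M.+1].

(** A further child of p(c), where [c] lies on the branch of the last vertex. Later siblings carry
    smaller identifiers and [c] is the latest child of p(c), so exactly the identifiers in [0, s_c)
    are allowed. There are none if s_c <= 0, which also discards the root. *)
Definition branch_ext (G : pregenogram) : seq (nat * int) :=
  [seq (par G c, s%:Z) | c <- [seq c <- size G :: anc G (size G) | 1 <= sid G c],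
                         s <- iota 0 (absz (sid G c))].

Definition nonneg_ext (M : nat) (G : pregenogram) : seq (nat * int) :=
  top_ext M G ++ branch_ext G.

(** Identifier -1 occurs only below the last vertex: a vertex that already has a child admits only
    nonnegative further ones. *)
Definition one_ext (M : nat) (G : pregenogram) : seq (nat * int) :=
  (size G, -1) :: nonneg_ext M G.

Lemma branch_extP G p s : reflect
  (exists c, [/\ c \in size G :: anc G (size G), p = par G c & 0 <= s < sid G c])
  ((p, s) \in branch_ext G).
Proof.
apply: (iffP idP).
  case/allpairsPdep => c [t [+ tc [-> ->]]]; rewrite mem_filter => /andP[c1 cc].
  by exists c; split => //; move: tc; rewrite mem_iota; lia.
case=> c [cc -> sc]; apply/allpairsPdep; exists c, (absz s).
rewrite mem_filter cc mem_iota; split; [|lia|congr (_, _); lia].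
by rewrite andbT; lia.
Qed.

Lemma top_extP M G p s : reflect (p = size G /\ 0 <= s <= M%:Z)
  ((p, s) \in top_ext M G).
Proof.
apply: (iffP idP); first by case/mapP => t; rewrite mem_iota => tM [-> ->]; split => //; lia.
case=> -> sM; apply/mapP; exists (absz s); first by rewrite mem_iota; lia.
congr (_, _); lia.
Qed.

Lemma branch_ext_par G p s : genogram_spec G -> (p, s) \in branch_ext G ->
  (0 < p < size G)%N /\ p \in anc G (size G).
Proof.
move=> hG /branch_extP[c [cc -> sc]].
have nG : (0 < size G <= size G)%N by rewrite (gs_size hG) /=.
have cG : (0 < c <= size G)%N.
  by move: cc; rewrite inE => /predU1P[->//|/(anc_lt hG nG)]; lia.
have c1 : (1 < c)%N.
  by case: c cc sc cG => [|[|c]] // _; rewrite (gs_sid1 hG); lia.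
have [p0 pc _] := gs_tree hG (j := c) ltac:(lia).
split; first lia.
move: cc; rewrite inE => /predU1P[E|cc].
  by rewrite E (anc_rec hG) ?inE ?eqxx//; lia.
have /sub_anc h : c \in size G :: anc G (size G) by rewrite inE cc orbT.
have := h hG nG (par G c); rewrite [anc G c]anc_rec// ?inE ?eqxx ?orbT ?inE; last lia.
by move/(_ isT)/orP => [/eqP ?|//]; lia.
Qed.

Lemma uniq_nonneg_ext M G : genogram_spec G -> uniq (nonneg_ext M G).
Proof.
move=> hG; have nG : (0 < size G <= size G)%N by rewrite (gs_size hG) /=.
rewrite cat_uniq; apply/and3P; split.
- by rewrite map_inj_uniq ?iota_uniq// => i j [].
- apply/hasPn => -[p s] /(branch_ext_par hG)[? _]; apply/negP => /top_extP[]; lia.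
- have c1 c : c \in [seq c <- size G :: anc G (size G) | 1 <= sid G c] ->
    c \in size G :: anc G (size G) /\ (1 < c)%N.
    rewrite mem_filter => /andP[sc cc]; split => //.
    have : (0 < c)%N by move: cc; rewrite inE => /predU1P[->|/(anc_lt hG nG)]; lia.
    by case: c sc {cc} => [|[|c]] //; rewrite (gs_sid1 hG).
  apply: allpairs_uniq_dep.
  + by apply: filter_uniq; exact: chain_uniq.
  + by move=> c _; exact: iota_uniq.
  + move=> [c s] [c' s'] /allpairsPdep[x [y [xc _ [-> ->]]]]
      /allpairsPdep[x' [y' [xc' _ [-> ->]]]] /= [E ->].
    have [? ?] := c1 _ xc; have [? ?] := c1 _ xc'.
    by rewrite (par_inj_chain hG nG _ _ _ _ E).
Qed.

Lemma uniq_one_ext M G : genogram_spec G -> uniq (one_ext M G).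
Proof.
move=> hG; rewrite /one_ext cons_uniq uniq_nonneg_ext// andbT mem_cat negb_or.
apply/andP; split; first by apply/negP => /top_extP[]; lia.
by apply/negP => /branch_extP[? []]; lia.
Qed.

(** The new vertex has the largest label, so it is the later one in every condition on pairs. The
    last clause bounds the parents of all vertices after v[p] from below by [p], which puts v[p] on
    the branch of the last vertex. *)
Lemma genogram_rconsP G p s : genogram_spec G -> genogram_spec (rcons G (p, s)) <->
  [/\ (0 < p <= size G)%N, -1 <= s, (p = 1%N -> 0 <= s),
      (forall i, (1 < i <= size G)%N -> par G i = p -> 0 <= s < sid G i) &
      (forall j, (p <= j < size G)%N -> (p <= par G j.+1)%N)].
Proof.
move=> hG; have G0 := gs_size hG; set G' := rcons G (p, s).
have pl : par G' (size G).+1 = p := par_rcons_last _ _ _.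
have sl : sid G' (size G).+1 = s := sid_rcons_last _ _ _.
have pE j : (j <= size G)%N -> par G' j = par G j by exact: par_rcons_lt.
have sE j : (j <= size G)%N -> sid G' j = sid G j by exact: sid_rcons_lt.
have sz : size G' = (size G).+1 by rewrite size_rcons.
split=> [h|[h1 h2 h3 h4 h5]].
  have [] := gs_tree h (j := (size G).+1); first by rewrite sz; lia.
  rewrite pl sl => h1 h2 h3; split=> //; first lia.
  - by move=> p1; have := gs_root h (j := (size G).+1); rewrite sz pl sl; apply => //; lia.
  - move=> i iG pi; have := gs_sib h (i := i) (j := (size G).+1).
    by rewrite sz pl sl sE ?pE; last lia; last lia; apply => //; lia.
  - move=> j jG; have := gs_label h (j := j) (c := (size G).+1).
    by rewrite sz pl pE; last lia; apply; lia.
split; first by rewrite sz.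
- by rewrite pE// (gs_par1 hG).
- by rewrite sE// (gs_sid1 hG).
- move=> j; rewrite sz => jG; have [jG'|jG'] := leqP j (size G).
    by rewrite pE// sE//; apply: gs_tree => //; lia.
  have -> : j = (size G).+1 by lia.
  by rewrite pl sl; split => //; lia.
- move=> j; rewrite sz => jG; have [jG'|jG'] := leqP j (size G).
    by rewrite pE// sE//; apply: gs_root => //; lia.
  have -> : j = (size G).+1 by lia.
  by rewrite pl sl.
- move=> i j i1 ij; rewrite sz => jG; have [jG'|jG'] := leqP j (size G).
    by rewrite !pE ?sE; try lia; apply: gs_sib => //; lia.
  have -> : j = (size G).+1 by lia.
  by rewrite pl sl pE ?sE; try lia; apply: h4; lia.
- move=> j c j0 jc; rewrite sz => cG; have [cG'|cG'] := leqP c (size G).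
    by rewrite !pE; try lia; apply: gs_label => //; lia.
  have -> : c = (size G).+1 by lia.
  rewrite pl => pj; have [jG|jG] := ltnP j (size G); first by rewrite pE//; apply: h5; lia.
  have -> : j = size G by lia.
  by rewrite pl.
Qed.

Lemma genogram_nonneg_ext M G x : genogram_spec G -> x \in nonneg_ext M G ->
  genogram_spec (rcons G x).
Proof.
move=> hG; have nG : (0 < size G <= size G)%N by rewrite (gs_size hG) /=.
case: x => p s; rewrite mem_cat => /orP[/top_extP[-> sM]|xb]; apply/genogram_rconsP => //.
  split=> //; try lia; move=> i iG pi; have [] := gs_tree hG iG; lia.
have [p0 pA] := branch_ext_par hG xb.
case/branch_extP: xb => c [cc pE sc].
have cG : (0 < c <= size G)%N.
  by move: cc; rewrite inE => /predU1P[->//|/(anc_lt hG nG)]; lia.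
have c1 : (1 < c)%N.
  by case: c cc sc {pE} cG => [|[|c]] // _; rewrite (gs_sid1 hG); lia.
split=> //; try lia.
  move=> i iG pi; have [ci|ic|<-//] := ltngtP c i.
    have [_ pc _] := gs_tree hG (j := c) ltac:(lia).
    by have := par_ge_chain hG nG cc (j := i); rewrite pi; lia.
  have := gs_sib hG (i := i) (j := c); lia.
move=> j jG; apply: (par_ge_chain hG nG); last lia.
by rewrite inE pA orbT.
Qed.

(** The order is at least 2 because a child of the root may not carry -1. *)
Lemma genogram_one_ext M G x : genogram_spec G -> (1 < size G)%N ->
  x \in one_ext M G -> genogram_spec (rcons G x).
Proof.
move=> hG G1; rewrite inE => /predU1P[->|]; last exact: genogram_nonneg_ext.
apply/genogram_rconsP => //; split=> //; try lia.
move=> i iG pi; have [] := gs_tree hG iG; lia.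
Qed.

Lemma mem_one_ext M G p s : genogram_spec G -> genogram_spec (rcons G (p, s)) ->
  s <= M%:Z -> (p, s) \in one_ext M G.
Proof.
move=> hG /(genogram_rconsP _ _ hG)[p0 s1 sp sib lab] sM.
have [pn|pn] : p = size G \/ (p < size G)%N by lia.
  have [->|s0] : s = -1 \/ 0 <= s by lia.
    by rewrite inE pn eqxx.
  rewrite inE mem_cat; apply/orP; right; apply/orP; left; apply/top_extP.
  by split=> //; lia.
(* On the way from v[n] to the root, the labeling clause keeps the parents at least [p], so the
   branch meets [p]. The vertex met just before is the sibling that bounds [s]. *)
have chain c : (p < c <= size G)%N ->
    exists2 c', c' \in c :: anc G c & par G c' = p.
  elim/ltn_ind: c => c IH cG; have [E|ne] := eqVneq (par G c) p.
    by exists c => //; rewrite inE eqxx.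
  have cG' : (1 < c <= size G)%N by lia.
  have [p0' pc _] := gs_tree hG cG'.
  have : (p <= par G c)%N by rewrite -(ltn_predK pc); apply: lab; lia.
  rewrite leq_eqVlt eq_sym (negPf ne) /= => ppc.
  have [|c' c'c E] := IH _ pc; first lia.
  by exists c' => //; rewrite inE anc_rec// c'c orbT.
have [|c cn pc] := chain (size G); first by rewrite pn /=.
rewrite inE mem_cat; apply/orP; right; apply/orP; right; apply/branch_extP.
exists c; split => //; apply: sib => //.
have nG : (0 < size G <= size G)%N by rewrite (gs_size hG) /=.
have cG : (0 < c <= size G)%N.
  by move: cn; rewrite inE => /predU1P[->//|/(anc_lt hG nG)]; lia.
by case: c pc cG {cn} => [|[|c]] //; rewrite (gs_par1 hG); lia.
Qed.

Lemma genogram_take G n : genogram_spec G -> (0 < n)%N ->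
  genogram_spec (take n G).
Proof.
move=> hG n0; have [nG|nG] := leqP (size G) n; first by rewrite take_oversize.
have pE j : (j <= n)%N -> par (take n G) j = par G j.
  by move=> jn; rewrite /par nth_take//; lia.
have sE j : (j <= n)%N -> sid (take n G) j = sid G j.
  by move=> jn; rewrite /sid nth_take//; lia.
have sz : size (take n G) = n by rewrite size_take nG.
split; rewrite ?sz//.
- by rewrite pE// (gs_par1 hG).
- by rewrite sE// (gs_sid1 hG).
- by move=> j jn; rewrite pE ?sE; try lia; apply: gs_tree => //; lia.
- by move=> j jn; rewrite pE ?sE; try lia; apply: gs_root => //; lia.
- by move=> i j i1 ij jn; rewrite !pE ?sE; try lia; apply: gs_sib => //; lia.
- by move=> j c j0 jc cn; rewrite !pE; try lia; apply: gs_label => //; lia.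
Qed.

(** * Blocks, leaves and identifiers -1 after adding a vertex *)

Lemma nonroots_rcons G x : (0 < size G)%N ->
  nonroots (rcons G x) = rcons (nonroots G) (size G).+1.
Proof.
have E n : iota 2 n.+1 = rcons (iota 2 n) n.+2.
  by rewrite -[in LHS](addn1 n) iotaD cats1 add2n.
by move=> G0; rewrite /nonroots size_rcons -{1}(prednK G0) E prednK.
Qed.

Lemma labels_rcons G x : labels (rcons G x) = rcons (labels G) (size G).+1.
Proof. by rewrite /labels size_rcons -[in LHS](addn1 (size G)) iotaD cats1 add1n. Qed.

(** [q0] starts the last run of vertices that are each hung below their predecessor. A child of the
    last vertex prolongs this run; any other vertex starts a new one. *)
Lemma q0_rcons G p s : (0 < size G)%N ->
  q0 (rcons G (p, s)) = if p == size G then q0 G else (size G).+1.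
Proof.
move=> G0; rewrite /q0 nonroots_rcons// -cats1 big_cat big_cons big_nil /=.
have -> : (\max_(j <- nonroots G | par (rcons G (p, s)) j != j.-1) j =
    \max_(j <- nonroots G | par G j != j.-1) j)%N.
  rewrite [LHS]big_seq_cond [RHS]big_seq_cond; apply: eq_bigl => j.
  case: (boolP (j \in _)) => //; rewrite mem_nonroots// => jG.
  by rewrite par_rcons_lt//; lia.
rewrite par_rcons_last; case: eqP => _ /=; first by rewrite maxn0.
have : (\max_(j <- nonroots G | par G j != j.-1) j <= size G)%N.
  rewrite big_seq_cond; apply/bigmax_leqP_seq => j _; rewrite mem_nonroots//.
  by move=> /andP[/andP[]].
by move: (\max_(_ <- _ | _) _)%N => M; rewrite maxn0; lia.
Qed.

Lemma qs_rcons G p s : (0 < size G)%N ->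
  qs (rcons G (p, s)) =
  if p == size G then qs G ++ [seq t <- [:: (size G).+1] | 0 <= s] else [::].
Proof.
move=> G0; have /andP[q1 qG] := q0_bounds G0.
rewrite /qs q0_rcons// size_rcons; case: eqP => _; last by rewrite subnn.
rewrite subSn// -(addn1 (size G - q0 G)) iotaD filter_cat addSn subnKC//; congr (_ ++ _).
  by apply: eq_in_filter => t; rewrite mem_iota => tG; rewrite sid_rcons_lt//; lia.
by rewrite /= sid_rcons_last.
Qed.

Lemma minus_ones_rcons G p s : (0 < size G)%N ->
  minus_ones (rcons G (p, s)) = (minus_ones G + (s == -1)%R)%N.
Proof.
move=> G0; rewrite /minus_ones labels_rcons -[rcons (labels G) _]cats1 count_cat /= sid_rcons_last addn0.
congr addn; apply: eq_in_count => l; rewrite mem_labels => lG.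
by rewrite sid_rcons_lt//; lia.
Qed.

Lemma leaves_rcons_aux G p s : genogram_spec G -> (p <= size G)%N ->
  leaves (rcons G (p, s)) =
  (count (fun l => ~~ has (fun c => par G c == l) (nonroots G) && (l != p)) (labels G)).+1.
Proof.
move=> hG pG; have G0 := gs_size hG.
have E l : has (fun c => par (rcons G (p, s)) c == l) (nonroots (rcons G (p, s))) =
    has (fun c => par G c == l) (nonroots G) || (p == l).
  rewrite nonroots_rcons// has_rcons par_rcons_last orbC; congr orb.
  by apply: eq_in_has => c; rewrite mem_nonroots// => cG; rewrite par_rcons_lt//; lia.
rewrite /leaves labels_rcons -[rcons (labels G) _]cats1 count_cat /= E addn0.
have -> : has (fun c => par G c == (size G).+1) (nonroots G) = false.
  apply/hasPn => c; rewrite mem_nonroots// => cG.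
  by have [_ pc _] := gs_tree hG cG; lia.
have -> : (p == (size G).+1) = false by lia.
rewrite addn1; congr S; apply: eq_count => l; by rewrite E negb_or eq_sym.
Qed.

(** The last vertex of a genogram is a leaf; it ceases to be one, and the new vertex takes its
    place. *)
Lemma leaves_rcons_top G s : genogram_spec G ->
  leaves (rcons G (size G, s)) = leaves G.
Proof.
move=> hG; have G0 := gs_size hG.
rewrite leaves_rcons_aux// /leaves.
have -> : labels G = rcons (iota 1 (size G).-1) (size G).
  by rewrite /labels -{1}(prednK G0) -(addn1 (size G).-1) iotaD cats1 add1n prednK.
rewrite -cats1 !count_cat /= eqxx andbF addn0.
have -> : has (fun c => par G c == size G) (nonroots G) = false.
  apply/hasPn => c; rewrite mem_nonroots// => cG.
  by have [_ pc _] := gs_tree hG cG; lia.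
rewrite addn1 addn0; congr S; apply: eq_in_count => l; rewrite mem_iota => lG.
have -> : l != size G by lia.
by rewrite andbT.
Qed.

(** The parent already has the child [c], so no leaf is lost. *)
Lemma leaves_rcons_branch G p s : genogram_spec G -> (p, s) \in branch_ext G ->
  leaves (rcons G (p, s)) = (leaves G).+1.
Proof.
move=> hG hb; have [pG pA] := branch_ext_par hG hb.
rewrite leaves_rcons_aux//; last lia.
congr S; apply: eq_count => l; have [->|] := eqVneq l p; last by rewrite andbT.
rewrite andbF; apply/esym/negbTE; rewrite negbK.
case/branch_extP: hb => c [cc pE sc].
have nG : (0 < size G <= size G)%N by rewrite (gs_size hG) /=.
apply/hasP; exists c; last by rewrite pE.
have : (0 < c <= size G)%N.
  by move: cc; rewrite inE => /predU1P[->//|/(anc_lt hG nG)]; lia.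
rewrite mem_nonroots//; last by case/andP: nG.
by case: c cc pE sc => [|[|c]] //; rewrite (gs_sid1 hG); lia.
Qed.

(** * Constraint sets *)

Lemma anc_rcons_lt G x j : genogram_spec G -> (j <= size G)%N ->
  anc (rcons G x) j = anc G j.
Proof.
move=> hG jG; rewrite /anc; case: x => p s; have G0 := gs_size hG.
rewrite par_rcons_lt//; congr [seq l <- _ | (0 < l)%N].
suff h n l : (l <= size G)%N ->
    traject (par (rcons G (p, s))) l n = traject (par G) l n.
  by apply: h; apply: leq_trans (par_le hG jG) _; lia.
elim: n l => //= n IH l lG; rewrite par_rcons_lt// IH//.
by apply: leq_trans (par_le hG lG) _; lia.
Qed.

Lemma anc_rcons_last G p s : genogram_spec G -> genogram_spec (rcons G (p, s)) ->
  anc (rcons G (p, s)) (size G).+1 = p :: anc G p.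
Proof.
move=> hG hG'; have [pG _ _ _ _] := (genogram_rconsP _ _ hG).1 hG'.
rewrite (anc_rec hG') ?size_rcons ?par_rcons_last ?anc_rcons_lt//; lia.
Qed.

Lemma gidx_rcons_lt G x j : genogram_spec G -> (0 < j <= size G)%N ->
  gidx (rcons G x) j = gidx G j.
Proof.
move=> hG jG; rewrite /gidx anc_rcons_lt//; last by case/andP: jG.
congr (maxn _ _); rewrite [LHS]big_seq_cond [RHS]big_seq_cond.
apply: eq_bigl => l; case: (boolP (l \in _)) => // /(anc_lt hG jG) lj.
by case: x => p s; rewrite sid_rcons_lt ?(gs_size hG)//; lia.
Qed.

Lemma uidx_rcons_lt G x j : genogram_spec G -> (0 < j <= size G)%N ->
  uidx (rcons G x) j = uidx G j.
Proof.
move=> hG jG; rewrite /uidx anc_rcons_lt//; last by case/andP: jG.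
rewrite [LHS]big_seq_cond [RHS]big_seq_cond.
apply: eq_bigl => l; case: (boolP (l \in _)) => // lj.
have {}lj : (0 < l <= j)%N.
  by move: lj; rewrite inE => /predU1P[->|/(anc_lt hG jG)]; lia.
by case: x => p s; rewrite sid_rcons_lt ?(gs_size hG)//; lia.
Qed.

(** The new vertex is a sibling of [c] and has the same ancestors. *)
Lemma gidx_rcons_last G c s : genogram_spec G -> (1 < c <= size G)%N ->
  genogram_spec (rcons G (par G c, s)) ->
  gidx (rcons G (par G c, s)) (size G).+1 = gidx G c.
Proof.
move=> hG cG hG'; rewrite /gidx anc_rcons_last// -anc_rec//.
congr (maxn _ _); rewrite [LHS]big_seq_cond [RHS]big_seq_cond.
apply: eq_bigl => l; case: (boolP (l \in _)) => // /(anc_lt hG) lj.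
by rewrite sid_rcons_lt ?(gs_size hG)//; lia.
Qed.

Lemma gidx_cases G j : genogram_spec G -> (1 < j <= size G)%N ->
  gidx G j = if (par G j == 1%N) || (1 <= sid G (par G j)) then par G j
             else gidx G (par G j).
Proof.
move=> hG jG; have [p0 pj _] := gs_tree hG jG.
rewrite /gidx anc_rec// big_cons.
have bd : (\max_(l <- anc G (par G j) | (1 <= sid G l)%R) l <= (par G j).-1)%N.
  rewrite big_seq_cond; apply/bigmax_leqP_seq => l _ /andP[/(anc_lt hG)]; lia.
case: eqP => [E|ne] /=.
  by rewrite E (gs_sid1 hG) anc1// big_nil.
by case: ifP => // _; lia.
Qed.

Lemma uidx_nonneg G j : genogram_spec G -> (0 < j <= size G)%N ->
  0 <= sid G j -> uidx G j = j.
Proof.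
move=> hG jG sj; rewrite /uidx big_cons sj; apply/maxn_idPl.
rewrite big_seq_cond; apply/bigmax_leqP_seq => l _ /andP[/(anc_lt hG)]; lia.
Qed.

Lemma uidx_neg G j : genogram_spec G -> (1 < j <= size G)%N ->
  sid G j < 0 -> uidx G j = uidx G (par G j).
Proof.
by move=> hG jG sj; rewrite /uidx big_cons leNgt sj /= anc_rec.
Qed.

Lemma uidx_le G j : genogram_spec G -> (0 < j <= size G)%N ->
  (0 < uidx G j <= j)%N.
Proof.
move=> hG jG; have [sj|sj] := leP 0 (sid G j); first by rewrite uidx_nonneg//; lia.
have j1 : (1 < j)%N by case: j jG sj => [|[|j]] //; rewrite (gs_sid1 hG).
have := uidx_lt (introT (genogramP _) hG) (j := j).
by move=> /(_ ltac:(lia) sj); lia.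
Qed.

Section BDsets.
Context (d : nat) (T : {fset 'rV[int]_d}) (m : nat) (prec : rel 'rV[int]_d).
Local Notation point := 'rV[int]_d.
Local Notation B := (Bset T m prec).
Local Notation D := (Dset T m prec).

Lemma BDset1 G ii : B G ii 1 = T /\ D G ii 1 = fset0.
Proof. by []. Qed.

Local Opaque Bset Dset.

Lemma pt_rcons_lt (ii : seq point) i l : (0 < l <= size ii)%N ->
  pt (rcons ii i) l = pt ii l.
Proof. by case: l => // l lii; rewrite /pt nth_rcons ifT. Qed.

Lemma pt_rcons_last (ii : seq point) i : pt (rcons ii i) (size ii).+1 = i.
Proof. by rewrite /pt nth_rcons ltnn eqxx. Qed.

Lemma anc_pts_eq (G G' : pregenogram) (ii ii' : seq point) j j' :
  anc G j = anc G' j' -> (forall l, l \in anc G j -> pt ii l = pt ii' l) ->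
  anc_pts G ii j = anc_pts G' ii' j'.
Proof.
move=> E h; apply/fsetP => x; rewrite !inE -E.
by apply: (congr1 (fun s => x \in s)); apply/eq_in_map.
Qed.

Lemma BDset_rcons_lt G x ii j : genogram_spec G -> genogram_spec (rcons G x) ->
  (0 < j <= size G)%N ->
  B (rcons G x) ii j = B G ii j /\ D (rcons G x) ii j = D G ii j.
Proof.
move=> hG hG'; elim/ltn_ind: j => j IH jG.
have [j1|j1] := leqP j 1; first by have -> : j = 1%N by lia;
  rewrite !(BDset1 _ _).1 !(BDset1 _ _).2.
have jG' : (1 < j <= size G)%N by lia.
have jG'' : (1 < j <= size (rcons G x))%N by rewrite size_rcons; lia.
have gG := introT (genogramP _) hG; have gG' := introT (genogramP _) hG'.
have := gidx_lt gG jG'; have := @uidx_lt _ _ gG jG'.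
rewrite (Dset_rec _ _ _ _ gG jG') (Dset_rec _ _ _ _ gG' jG'').
rewrite (Bset_rec _ _ _ _ gG jG') (Bset_rec _ _ _ _ gG' jG'').
rewrite gidx_rcons_lt// uidx_rcons_lt//.
have -> : sid (rcons G x) j = sid G j.
  by case: x {hG' IH jG'' gG'} => p s; rewrite sid_rcons_lt// ?(gs_size hG)//; lia.
move=> hu hg; have [_ ->] := IH (gidx G j) ltac:(lia) ltac:(lia).
have -> : anc_pts (rcons G x) ii j = anc_pts G ii j.
  by apply: anc_pts_eq => //; rewrite anc_rcons_lt//; lia.
split; last reflexivity.
case: (leP 0 (sid G j)) => sj; first reflexivity.
have [-> _] := IH (uidx G j) ltac:(lia) ltac:(lia); reflexivity.
Qed.

(** The recursion consults only points of ancestors and earlier sets. Hence an index can be appended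
    without changing the sets already in use. *)
Lemma BDset_pts G ii ii' j : genogram_spec G -> (0 < j <= size G)%N ->
  (forall l, (0 < l < j)%N -> pt ii l = pt ii' l) ->
  B G ii j = B G ii' j /\ D G ii j = D G ii' j.
Proof.
move=> hG; elim/ltn_ind: j => j IH jG hpt.
have [j1|j1] := leqP j 1; first by have -> : j = 1%N by lia;
  rewrite !(BDset1 _ _).1 !(BDset1 _ _).2.
have jG' : (1 < j <= size G)%N by lia.
have gG := introT (genogramP _) hG.
have := gidx_lt gG jG'; have := @uidx_lt _ _ gG jG'.
rewrite !(Dset_rec _ _ _ _ gG jG') !(Bset_rec _ _ _ _ gG jG').
move=> hu hg; have [|_ ->] := IH (gidx G j) ltac:(lia) ltac:(lia).
  by move=> l lg; apply: hpt; lia.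
have -> : anc_pts G ii j = anc_pts G ii' j.
  by apply: anc_pts_eq => // l /(anc_lt hG jG) ?; apply: hpt; lia.
split; last reflexivity.
case: (leP 0 (sid G j)) => sj; first reflexivity.
have [|-> _] := IH (uidx G j) ltac:(lia) ltac:(lia); last reflexivity.
by move=> l lg; apply: hpt; lia.
Qed.

Lemma BDset_rcons_pts G ii i j : genogram_spec G -> (0 < j <= size G)%N ->
  (j <= (size ii).+1)%N ->
  B G (rcons ii i) j = B G ii j /\ D G (rcons ii i) j = D G ii j.
Proof.
move=> hG jG jii; apply: BDset_pts => // l lj; apply: pt_rcons_lt.
by case/andP: lj => -> /= /leq_trans/(_ jii).
Qed.

Lemma nbh_ext_sub s J : (nbh_ext T m prec s J `<=` T)%fset.
Proof.
by apply/fsubsetP => x; rewrite !inE => /orP[/andP[]|/andP[/andP[_]]].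
Qed.

Lemma nbh_ext_mono s s' J : (s <= s')%N ->
  (nbh_ext T m prec s J `<=` nbh_ext T m prec s' J)%fset.
Proof.
move=> ss; apply: fsetUS; apply/fsubsetP => x.
by rewrite !inE => /andP[-> /leq_trans]; exact.
Qed.

Lemma nbh_ext_full s J : (#|` T| <= s)%N -> nbh_ext T m prec s J = T.
Proof.
move=> Ts; apply/eqP; rewrite eqEfsubset nbh_ext_sub /=; apply/fsubsetP => x xT.
have [xN|xN] := boolP (x \in nbh T m J); first by rewrite inE xN.
rewrite in_fsetU; apply/orP; right.
suff rkx : (rk T m prec x J <= s)%N by move: xN; rewrite !inE xT rkx /= andbT => ->.
apply: leq_trans Ts; apply: (@leq_trans (size (T `\` nbh T m J)%fset)).
  by rewrite /rk -(size_sort (dist_prec_le prec J)) index_mem mem_sort in_fsetD xN.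
by apply: fsubset_leq_card; exact: fsubsetDl.
Qed.

Lemma BDset_sub G ii j : genogram_spec G -> (0 < j <= size G)%N ->
  (D G ii j `<=` B G ii j)%fset && (B G ii j `<=` T)%fset.
Proof.
move=> hG.
(* The clause D_(u(j)) = D_j carries the induction through identifier -1, where B_j = B_(u(j)) but
   D_j = D_(g(j)). *)
suff h : forall j, (0 < j <= size G)%N ->
   [/\ D G ii j `<=` B G ii j, B G ii j `<=` T & D G ii (uidx G j) = D G ii j]%fset.
  by case/h => -> ->.
elim/ltn_ind => {}j IH jG.
have [j1|j1] := leqP j 1.
  have -> : j = 1%N by lia.
  by rewrite uidx_nonneg ?(gs_sid1 hG) ?(gs_size hG)//
    (BDset1 _ _).1 (BDset1 _ _).2 fsub0set fsubset_refl.
have jG' : (1 < j <= size G)%N by lia.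
have gG := introT (genogramP _) hG.
have [g0 gj] := andP (gidx_lt gG jG').
have [Dg Bg _] := IH _ gj ltac:(lia).
have [p0 pj _] := gs_tree hG jG'.
have [sj|sj] := leP 0 (sid G j).
  rewrite uidx_nonneg//; split => //.
    rewrite (Bset_rec _ _ _ _ gG jG') (Dset_rec _ _ _ _ gG jG') sj; case: ifP => s1; last by rewrite fsubsetUr.
    by apply: fsetSU; apply: nbh_ext_mono; lia.
  rewrite (Bset_rec _ _ _ _ gG jG') sj fsubUset nbh_ext_sub /=.
  exact: fsubset_trans Dg Bg.
have hu := uidx_lt gG jG' sj.
have [Du Bu _] := IH (uidx G j) ltac:(lia) ltac:(lia).
rewrite (Bset_rec _ _ _ _ gG jG') leNgt sj /=.
suff E : D G ii (uidx G j) = D G ii j by rewrite -E.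
have [_ _ Ep] := IH (par G j) pj ltac:(lia).
rewrite (Dset_rec _ _ _ _ gG jG') uidx_neg// Ep.
have -> : (1 <= sid G j) = false by lia.
rewrite gidx_cases//; case: ifP => // /negbT; rewrite negb_or => /andP[ne s1].
rewrite (Dset_rec _ _ _ _ gG); last lia.
by rewrite (negPf s1).
Qed.

(** If the parent is not the root and its identifier is not positive, then g(j) = g(p(j)), and the
    parent itself inherits D_(g(p(j))). *)
Lemma Dset_gidx G ii j : genogram_spec G -> (1 < j <= size G)%N ->
  D G ii (gidx G j) = D G ii (par G j).
Proof.
move=> hG jG; rewrite gidx_cases//; case: ifP => // /negbT.
rewrite negb_or => /andP[ne s1]; have [p0 pj _] := gs_tree hG jG.
by rewrite [RHS](Dset_rec _ _ _ _ (introT (genogramP _) hG)) ?(negPf s1)//; lia.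
Qed.

(** Both neighborhoods have already exhausted [T], so v[j] has no admissible index. *)
Lemma BDset_full G ii j : genogram_spec G -> (1 < j <= size G)%N ->
  (#|` T|)%:Z < sid G j -> B G ii j = D G ii j.
Proof.
move=> hG jG sj; have gG := introT (genogramP _) hG.
rewrite (Bset_rec _ _ _ _ gG jG) (Dset_rec _ _ _ _ gG jG).
have -> : 0 <= sid G j by lia.
have -> : 1 <= sid G j by lia.
by rewrite !nbh_ext_full//; lia.
Qed.

(* The sets attached to a new vertex hung below the parent of [c] form an
   increasing chain indexed by its identifier, which starts at [D G ii (gidx G c)]
   and passes through [D G ii c]. *)
Definition Dchain G ii c (s : nat) : {fset point} :=
  if s is s'.+1 then
    (nbh_ext T m prec s' (anc_pts G ii c) `|` D G ii (gidx G c))%fset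
  else D G ii (gidx G c).

Lemma Dchain_sid G ii c : genogram_spec G -> (1 < c <= size G)%N ->
  0 <= sid G c -> D G ii c = Dchain G ii c (absz (sid G c)).
Proof.
move=> hG cG sc; rewrite (Dset_rec _ _ _ _ (introT (genogramP _) hG) cG).
case: ifP => s1; last by have -> : sid G c = 0 by lia.
by have <- : (absz (sid G c - 1)).+1 = absz (sid G c) by lia.
Qed.

Lemma Dchain_full G ii c s : genogram_spec G -> (1 < c <= size G)%N ->
  (#|` T| < s)%N -> Dchain G ii c s = T.
Proof.
move=> hG cG; case: s => // s sT; rewrite /= nbh_ext_full//.
have := gidx_lt (introT (genogramP _) hG) cG => hg.
have /andP[DB BT] := BDset_sub ii hG (j := gidx G c) ltac:(lia).
by apply/fsetUidPl; apply: fsubset_trans DB BT.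
Qed.

(** A vertex of identifier [s] occupies the gap between the consecutive members [s] and [s.+1] of
    the chain; this is what makes sums over identifiers telescope. *)
Lemma BDset_Dchain G ii c s : genogram_spec G -> (1 < c <= size G)%N ->
  sid G c = s%:Z ->
  B G ii c = Dchain G ii c s.+1 /\ D G ii c = Dchain G ii c s.
Proof.
move=> hG cG sc; rewrite (Dchain_sid _ hG)// ?sc//; split => //.
by rewrite (Bset_rec _ _ _ _ (introT (genogramP _) hG) cG) sc.
Qed.

(** The new vertex shares its ancestors with [c], so the chain is the same for every identifier
    [s]. *)
Lemma Dchain_rcons_branch G ii c s : genogram_spec G -> (1 < c <= size G)%N ->
  genogram_spec (rcons G (par G c, s)) ->
  Dchain (rcons G (par G c, s)) ii (size G).+1 =1 Dchain G ii c.
Proof.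
move=> hG cG hG'.
have E : D (rcons G (par G c, s)) ii (gidx (rcons G (par G c, s)) (size G).+1) = D G ii (gidx G c).
  rewrite gidx_rcons_last//; have := gidx_lt (introT (genogramP _) hG) cG => hg.
  by have [] := BDset_rcons_lt ii (j := gidx G c) hG hG' ltac:(lia).
move=> [|t] /=; rewrite E//.
have -> // : anc_pts (rcons G (par G c, s)) ii (size G).+1 = anc_pts G ii c.
by apply: anc_pts_eq => //; rewrite anc_rcons_last// -anc_rec.
Qed.

Lemma Dchain_rcons_top G ii s t : genogram_spec G ->
  genogram_spec (rcons G (size G, s)) ->
  Dchain (rcons G (size G, s)) ii (size G).+1 t =
  if t is t'.+1 then
    (nbh_ext T m prec t' [fset x in [seq pt ii l | l <- size G :: anc G (size G)]]%fset
     `|` D G ii (size G))%fset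
  else D G ii (size G).
Proof.
move=> hG hG'; have G0 := gs_size hG.
have E : D (rcons G (size G, s)) ii (gidx (rcons G (size G, s)) (size G).+1) = D G ii (size G).
  rewrite Dset_gidx// ?size_rcons ?par_rcons_last//; last by rewrite ltnS G0 /=.
  by have [|_ ->] := BDset_rcons_lt ii (j := size G) hG hG'; rewrite ?G0 /=.
by case: t => [|t] /=; rewrite E// /anc_pts anc_rcons_last.
Qed.

End BDsets.

(** * Expectation operators *)

Section Expectation.
Context (R : realType) (disp : measure_display) (Omega : measurableType disp)
  (P : probability Omega R).
Local Notation rv := (Omega -> R).

Lemma finite_Ex_cst c : finite_Ex P (cst c).
Proof. exact: finite_measure_integrable_cst. Qed.

Lemma finite_Ex_lin a (Y Z : rv) : finite_Ex P Y -> finite_Ex P Z ->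
  finite_Ex P (fun w => a * Y w + Z w).
Proof.
move=> iY iZ.
have := @integrableD _ _ _ P setT measurableT _ _
  (@integrableZl _ _ _ P setT measurableT a _ iY) iZ.
by apply: eq_integrable.
Qed.

Lemma Ex_lin a (Y Z : rv) : finite_Ex P Y -> finite_Ex P Z ->
  Ex P (fun w => a * Y w + Z w) = a * Ex P Y + Ex P Z.
Proof.
move=> iY iZ; rewrite /Ex unlock.
have iaY := @integrableZl _ _ _ P setT measurableT a _ iY.
have -> : (\int[P]_w (a * Y w + Z w)%:E = a%:E * \int[P]_w (Y w)%:E + \int[P]_w (Z w)%:E)%E.
  by rewrite -integralZl// -integralD.
have fY := integrable_fin_num measurableT iY.
have fZ := integrable_fin_num measurableT iZ.
by rewrite fineD// ?fineM// fin_numM.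
Qed.

Lemma Ex_cst c : Ex P (cst c) = c.
Proof. by rewrite /Ex expectation_cst. Qed.

(** The variable before centering: [Dop] is [core] minus its mean and [Dstar] is that mean, so one
    recursion serves both operators. *)
Fixpoint core (Ys : seq rv) : rv :=
  match Ys with
  | [::] => cst 0
  | [:: Y] => Y
  | Y :: Ys' => fun w => Y w * Dop P Ys' w
  end.

Lemma Dop_core Ys : Dop P Ys = (fun w => core Ys w - Ex P (core Ys)).
Proof. by case: Ys => [|Y [|? ?]] //=; apply/funext => w; rewrite Ex_cst subrr. Qed.

Lemma Dstar_core Ys : Dstar P Ys = Ex P (core Ys).
Proof. by case: Ys => [|Y [|? ?]] //=; rewrite Ex_cst. Qed.

Lemma core_cons Y Ys : Ys != [::] -> core (Y :: Ys) = (fun w => Y w * Dop P Ys w).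
Proof. by case: Ys. Qed.

Lemma Dstar_finite_cons Y Ys : Dstar_finite P (Y :: Ys) <->
  Dstar_finite P Ys /\ finite_Ex P (core (Y :: Ys)).
Proof. by case: Ys => [|? ?] //=; split=> // -[]. Qed.

Lemma Dstar_finite_core Ys : Dstar_finite P Ys -> finite_Ex P (core Ys).
Proof.
by case: Ys => [_|Y Ys /Dstar_finite_cons[]//]; exact: finite_Ex_cst.
Qed.

Lemma core_rcons_cons b bl Z : core (rcons (b :: bl) Z) =
  (fun w => b w * (core (rcons bl Z) w - Ex P (core (rcons bl Z)))).
Proof. by rewrite rcons_cons core_cons ?Dop_core//; case: bl. Qed.

Lemma core_rcons_lin bl a (Y Z : rv) :
  Dstar_finite P (rcons bl Y) -> Dstar_finite P (rcons bl Z) ->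
  Dstar_finite P (rcons bl (fun w => a * Y w + Z w)) /\
  core (rcons bl (fun w => a * Y w + Z w)) =
  (fun w => a * core (rcons bl Y) w + core (rcons bl Z) w).
Proof.
elim: bl => [|b bl IH].
  by move=> fY fZ; split => //; exact: finite_Ex_lin.
move=> /Dstar_finite_cons[fY cY] /Dstar_finite_cons[fZ cZ].
have [f E] := IH fY fZ.
have E' : core (rcons (b :: bl) (fun w => a * Y w + Z w)) =
    (fun w => a * core (rcons (b :: bl) Y) w + core (rcons (b :: bl) Z) w).
  apply/funext => w; rewrite !core_rcons_cons E Ex_lin; first by ring.
    exact: Dstar_finite_core.
  exact: Dstar_finite_core.
split => //; apply/Dstar_finite_cons; split => //.
by rewrite -rcons_cons E'; exact: finite_Ex_lin.
Qed.

(** Behind an earlier block the last variable is centered, and a constant dies; alone it is not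
    centered and survives, whence the case on [bl]. *)
Lemma core_rcons_cst bl c : Dstar_finite P (rcons bl (cst c)) /\
  core (rcons bl (cst c)) = cst (if nilp bl then c else 0).
Proof.
elim: bl => [|b bl [f E]]; first by split => //=; exact: finite_Ex_cst.
have E' : core (rcons (b :: bl) (cst c)) = cst 0.
  by apply/funext => w; rewrite core_rcons_cons E Ex_cst subrr mulr0.
split => //; apply/Dstar_finite_cons; split => //.
by rewrite -rcons_cons E'; exact: finite_Ex_cst.
Qed.

Lemma core_rcons_sum (I : eqType) (r : seq I) bl (a : I -> R) (Z : I -> rv) :
  (forall i, i \in r -> Dstar_finite P (rcons bl (Z i))) ->
  Dstar_finite P (rcons bl (fun w => \sum_(i <- r) a i * Z i w)) /\
  core (rcons bl (fun w => \sum_(i <- r) a i * Z i w)) =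
  (fun w => \sum_(i <- r) a i * core (rcons bl (Z i)) w).
Proof.
elim: r => [_|i r IH h].
  have -> : (fun w => \sum_(i <- [::]) a i * Z i w) = cst 0.
    by apply/funext => w; rewrite big_nil.
  have [f ->] := core_rcons_cst bl 0; split => //.
  by apply/funext => w; rewrite big_nil; case: ifP.
have [f E] := IH (fun j jr => h j (mem_behead (s := i :: r) jr)).
have -> : (fun w => \sum_(i <- i :: r) a i * Z i w) =
    (fun w => a i * Z i w + (\sum_(i <- r) a i * Z i w)).
  by apply/funext => w; rewrite big_cons.
have [f' ->] := core_rcons_lin (a i) (h i (mem_head _ _)) f; split => //.
by apply/funext => w; rewrite big_cons E.
Qed.

Lemma Ex_sum (I : eqType) (r : seq I) (a : I -> R) (Y : I -> rv) :
  (forall i, i \in r -> finite_Ex P (Y i)) ->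
  finite_Ex P (fun w => \sum_(i <- r) a i * Y i w) /\
  Ex P (fun w => \sum_(i <- r) a i * Y i w) = \sum_(i <- r) a i * Ex P (Y i).
Proof.
elim: r => [_|i r IH h].
  have -> : (fun w => \sum_(i <- [::]) a i * Y i w) = cst 0.
    by apply/funext => w; rewrite big_nil.
  by rewrite big_nil Ex_cst; split => //; exact: finite_Ex_cst.
have [f E] := IH (fun j jr => h j (mem_behead (s := i :: r) jr)).
have -> : (fun w => \sum_(i <- i :: r) a i * Y i w) =
    (fun w => a i * Y i w + (\sum_(i <- r) a i * Y i w)).
  by apply/funext => w; rewrite big_cons.
have fi := h i (mem_head _ _).
by rewrite big_cons -E Ex_lin//; split => //; exact: finite_Ex_lin.
Qed.

(* Cutting the last block of [Dop] in two:
   D(Z F) = D(Z, F) + E[F] D(Z). *)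
Lemma core_rcons_mul bl (Z F : rv) :
  Dstar_finite P (rcons (rcons bl Z) F) -> Dstar_finite P (rcons bl Z) ->
  Dstar_finite P (rcons bl (fun w => Z w * F w)) /\
  core (rcons bl (fun w => Z w * F w)) =
  (fun w => Ex P F * core (rcons bl Z) w + core (rcons (rcons bl Z) F) w).
Proof.
elim: bl => [|b bl IH].
  move=> /= [fF fZF] fZ; have E : (fun w => Z w * F w) =
      (fun w => Ex P F * Z w + Z w * (F w - Ex P F)).
    by apply/funext => w; ring.
  by split => //; rewrite {1}E; exact: finite_Ex_lin.
move=> /Dstar_finite_cons[fZF cZF] /Dstar_finite_cons[fZ cZ].
have [f E] := IH fZF fZ.
have E' : core (rcons (b :: bl) (fun w => Z w * F w)) =
    (fun w => Ex P F * core (rcons (b :: bl) Z) w + core (rcons (rcons (b :: bl) Z) F) w).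
  apply/funext => w; rewrite rcons_cons [rcons (b :: _) F]rcons_cons -!rcons_cons.
  rewrite [core (rcons (b :: _) _)]core_rcons_cons [core (rcons (b :: bl) Z)]core_rcons_cons.
  rewrite [core (rcons (b :: rcons bl Z) _)]core_rcons_cons E Ex_lin; first by ring.
    exact: Dstar_finite_core.
  exact: Dstar_finite_core.
split => //; apply/Dstar_finite_cons; split => //.
by rewrite -rcons_cons E'; exact: finite_Ex_lin.
Qed.

End Expectation.

(** * The operator of a genogram extended by one vertex *)

Section Genogram.
Context (R : realType) (disp : measure_display) (Omega : measurableType disp)
  (P : probability Omega R).
Local Notation rv := (Omega -> R).
Implicit Types (G : pregenogram) (Ys : seq rv).

Definition block a b Ys : rv :=
  fun w => \prod_(a <= j < b) nth (cst 0) Ys j.-1 w.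

Definition last_start G : nat := last (q0 G) (qs G).

Definition init_blocks G Ys : seq rv :=
  [seq block ab.1 ab.2 Ys | ab <- zip (belast (q0 G) (qs G)) (qs G)].

Definition stem G Ys : R :=
  if q0 G == 1%N then 1 else EG P (take (q0 G).-1 G) (take (q0 G).-1 Ys).

Definition stem_finite G Ys : Prop :=
  q0 G != 1%N -> EG_finite P (take (q0 G).-1 G) (take (q0 G).-1 Ys).

Lemma qs_le G t : t \in qs G -> (q0 G < t <= size G)%N.
Proof.
rewrite mem_filter mem_iota => /andP[_]; have [|] := leqP (q0 G) (size G); lia.
Qed.

Lemma last_start_le G : (0 < size G)%N -> (0 < last_start G <= size G)%N.
Proof.
move=> G0; have qG := q0_bounds G0; have := mem_last (q0 G) (qs G).
rewrite /last_start; move: (last _ _) => t.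
by rewrite inE => /predU1P[->//|/qs_le]; lia.
Qed.

Lemma last_blocksE G Ys : last_blocks G Ys =
  rcons (init_blocks G Ys) (block (last_start G) (size G).+1 Ys).
Proof.
by rewrite /last_blocks lastI zip_rcons ?size_belast// map_rcons.
Qed.

Lemma block_eq a b Ys Ys' : (0 < a)%N ->
  (forall j, (a <= j < b)%N -> nth (cst 0) Ys j.-1 = nth (cst 0) Ys' j.-1) ->
  block a b Ys = block a b Ys'.
Proof.
by move=> a0 h; apply/funext => w; apply: eq_big_nat => j jab; rewrite h.
Qed.

Lemma init_blocks_rcons G Ys Z : (0 < size G)%N -> size Ys = (size G).-1 ->
  init_blocks G (rcons Ys Z) = init_blocks G Ys.
Proof.
move=> G0 sY; apply/eq_in_map => -[a b] h.
have aq : a \in belast (q0 G) (qs G).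
  by have := map_f fst h; rewrite -/(unzip1 _) unzip1_zip ?size_belast.
have bq : b \in qs G.
  by have := map_f snd h; rewrite -/(unzip2 _) unzip2_zip ?size_belast.
have qG := q0_bounds G0.
have a0 : (0 < a)%N.
  by move: aq => /mem_belast; rewrite inE => /predU1P[->|/qs_le]; lia.
have := qs_le bq => bG /=; apply: block_eq => // j jab.
by rewrite nth_rcons ifT// sY; lia.
Qed.

Lemma last_blocks_rcons G Ys Z : (0 < size G)%N -> size Ys = (size G).-1 ->
  last_blocks G (rcons Ys Z) =
  rcons (init_blocks G Ys) (fun w => block (last_start G) (size G) Ys w * Z w).
Proof.
move=> G0 sY; rewrite last_blocksE init_blocks_rcons//; congr rcons.
have lG := last_start_le G0.
apply/funext => w; rewrite /block big_nat_recr /=; last by case/andP: lG.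
rewrite nth_rcons sY ltnn eqxx; congr (_ * _).
by apply: eq_big_nat => j jab; rewrite nth_rcons ifT// sY; lia.
Qed.

Lemma EG_finite_rec_fuel n G Ys : (0 < size G <= n)%N ->
  EG_finite_rec P n G Ys <-> EG_finite P G Ys.
Proof.
move=> /andP[]; rewrite /EG_finite; move En : (size G) => N.
elim/ltn_ind: N n G Ys En => -[//|N] IH [//|n] G Ys En _ Nn.
have := @q0_bounds G; rewrite En => /(_ isT)/andP[q1 qG].
suff h : q0 G != 1%N -> (EG_finite_rec P n (take (q0 G).-1 G) (take (q0 G).-1 Ys) <->
    EG_finite_rec P N (take (q0 G).-1 G) (take (q0 G).-1 Ys)).
  by split => /= -[h1 h2]; split => // q; apply/h => //; exact: h1.
move=> q; have sq : size (take (q0 G).-1 G) = (q0 G).-1 by rewrite size_take; case: ifP; lia.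
have h1 := IH (q0 G).-1 ltac:(lia) n (take (q0 G).-1 G) (take (q0 G).-1 Ys) sq ltac:(lia) ltac:(lia).
have h2 := IH (q0 G).-1 ltac:(lia) N (take (q0 G).-1 G) (take (q0 G).-1 Ys) sq ltac:(lia) ltac:(lia).
by apply: (iff_trans h1); apply: iff_sym.
Qed.

Lemma EG_finiteE G Ys : (0 < size G)%N ->
  EG_finite P G Ys <-> stem_finite G Ys /\ Dstar_finite P (last_blocks G Ys).
Proof.
move=> G0; rewrite {1}/EG_finite -{1}(prednK G0) /= /stem_finite.
have /andP[q1 qG] := q0_bounds G0.
have sq : size (take (q0 G).-1 G) = (q0 G).-1 by rewrite size_take; case: ifP; lia.
have h : q0 G != 1%N -> (EG_finite_rec P (size G).-1 (take (q0 G).-1 G) (take (q0 G).-1 Ys) <->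
   EG_finite P (take (q0 G).-1 G) (take (q0 G).-1 Ys)).
  by move=> q; apply: EG_finite_rec_fuel; rewrite sq; lia.
by split => -[h1 h2]; split => // q; apply/h => //; exact: h1.
Qed.

Lemma EG_stem G Ys : (0 < size G)%N ->
  EG P G Ys = stem G Ys * Dstar P (last_blocks G Ys).
Proof. by move=> G0; rewrite EG_unfold// /stem; case: ifP; rewrite ?mul1r. Qed.

Lemma take_q0_rcons G Ys (Z : rv) : (0 < size G)%N -> ((size G).-1 <= size Ys)%N ->
  take (q0 G).-1 (rcons Ys Z) = take (q0 G).-1 Ys.
Proof.
move=> G0 sY; have /andP[q1 qG] := q0_bounds G0.
by rewrite -cats1 takel_cat//; lia.
Qed.

Section Last.
Context (G : pregenogram) (Ys : seq rv).
Hypotheses (G0 : (0 < size G)%N) (sY : size Ys = (size G).-1).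

Lemma EG_rconsE Z : EG P G (rcons Ys Z) = stem G Ys *
  Ex P (core P (rcons (init_blocks G Ys)
                      (fun w => block (last_start G) (size G) Ys w * Z w))).
Proof.
by rewrite EG_stem// /stem take_q0_rcons ?sY// last_blocks_rcons// Dstar_core.
Qed.

Lemma EG_finite_rconsE Z : EG_finite P G (rcons Ys Z) <-> stem_finite G Ys /\
  Dstar_finite P (rcons (init_blocks G Ys)
                        (fun w => block (last_start G) (size G) Ys w * Z w)).
Proof.
by rewrite EG_finiteE// /stem_finite take_q0_rcons ?sY// last_blocks_rcons.
Qed.

(** Finiteness of the stem is a separate assumption: an empty sum has no terms from which to draw
    it. *)
Lemma EG_rcons_sum (I : eqType) (r : seq I) (a : I -> R) (Z : I -> rv) :
  stem_finite G Ys ->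
  (forall i, i \in r -> EG_finite P G (rcons Ys (Z i))) ->
  EG_finite P G (rcons Ys (fun w => \sum_(i <- r) a i * Z i w)) /\
  EG P G (rcons Ys (fun w => \sum_(i <- r) a i * Z i w)) =
  \sum_(i <- r) a i * EG P G (rcons Ys (Z i)).
Proof.
move=> sf h; set c := block (last_start G) (size G) Ys.
have E : (fun w => c w * (\sum_(i <- r) a i * Z i w)) =
    (fun w => \sum_(i <- r) a i * (c w * Z i w)).
  by apply/funext => w; rewrite mulr_sumr; apply: eq_bigr => i _; ring.
have h' i : i \in r -> Dstar_finite P (rcons (init_blocks G Ys) (fun w => c w * Z i w)).
  by move/h/EG_finite_rconsE => -[].
have [f Ef] := core_rcons_sum a h'.
rewrite EG_finite_rconsE EG_rconsE E Ef; split => //.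
have [|_ ->] := @Ex_sum _ _ _ P _ r a
  (fun i => core P (rcons (init_blocks G Ys) (fun w => c w * Z i w))).
  by move=> i ir; apply: Dstar_finite_core; exact: h'.
by rewrite mulr_sumr; apply: eq_bigr => i _; rewrite EG_rconsE mulrCA.
Qed.

Lemma EG_rcons0 Z : Z =1 cst 0 -> EG P G (rcons Ys Z) = 0.
Proof.
move=> Z0; rewrite EG_rconsE.
have -> : (fun w => block (last_start G) (size G) Ys w * Z w) = cst 0.
  by apply/funext => w; rewrite Z0 mulr0.
have [_ ->] := core_rcons_cst P (init_blocks G Ys) 0.
by rewrite if_same Ex_cst mulr0.
Qed.

End Last.

Section Extension.
Context (G : pregenogram) (s : int).
Hypothesis G0 : (0 < size G)%N.
Let G' : pregenogram := rcons G (size G, s).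

Lemma q0_top : q0 G' = q0 G. Proof. by rewrite q0_rcons// eqxx. Qed.

Lemma stem_top Ys Z : size Ys = size G ->
  stem G' (rcons Ys Z) = stem G Ys /\ (stem_finite G' (rcons Ys Z) <-> stem_finite G Ys).
Proof.
move=> sY; have /andP[q1 qG] := q0_bounds G0.
rewrite /stem /stem_finite q0_top /G' -[rcons G _]cats1 takel_cat; last by lia.
by rewrite take_q0_rcons// sY; lia.
Qed.

(** A nonnegative identifier opens a new block, filled here by the last argument alone. *)
Lemma last_blocks_top Ys Z : 0 <= s -> size Ys = size G ->
  last_blocks G' (rcons Ys Z) = rcons (last_blocks G Ys) Z.
Proof.
move=> s0 sY; rewrite last_blocks_rcons ?size_rcons//.
have qE : qs G' = rcons (qs G) (size G).+1 by rewrite qs_rcons// eqxx /= s0 cats1.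
have sE : last_start G' = (size G).+1 by rewrite /last_start qE last_rcons.
have -> : (fun w => block (last_start G') (size G).+1 Ys w * Z w) = Z.
  by apply/funext => w; rewrite sE /block big_geq// mul1r.
congr rcons; rewrite /init_blocks qE q0_top belast_rcons lastI zip_rcons ?size_belast//.
by rewrite map_rcons last_blocksE.
Qed.

(** This lifts [core_rcons_mul] to genograms: the stem is a common factor of all terms. *)
Lemma EG_top Ys Z F : 0 <= s -> size Ys = (size G).-1 ->
  EG_finite P G' (rcons (rcons Ys Z) F) -> EG_finite P G (rcons Ys Z) ->
  EG_finite P G (rcons Ys (fun w => Z w * F w)) /\
  EG P G (rcons Ys (fun w => Z w * F w)) =
  EG P G (rcons Ys Z) * Ex P F + EG P G' (rcons (rcons Ys Z) F).
Proof.
move=> s0 sY; have sYZ : size (rcons Ys Z) = size G by rewrite size_rcons sY prednK.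
rewrite EG_finiteE ?size_rcons// (stem_top _ sYZ).2 last_blocks_top//.
rewrite [EG P G' _]EG_stem ?size_rcons// (stem_top _ sYZ).1 last_blocks_top//.
rewrite Dstar_core last_blocks_rcons// => -[sf DF] /EG_finite_rconsE[]// _ DZ.
have [f E] := core_rcons_mul DF DZ.
set c := block (last_start G) (size G) Ys.
have Ec : (fun w => c w * (Z w * F w)) = (fun w => (c w * Z w) * F w).
  by apply/funext => w; rewrite mulrA.
rewrite EG_finite_rconsE// !EG_rconsE// Ec E; split.
  by split => //; move: sf; rewrite /stem_finite take_q0_rcons// sY.
rewrite (Ex_lin _ (Dstar_finite_core DZ) (Dstar_finite_core DF)).
by rewrite /stem take_q0_rcons ?sY//; ring.
Qed.

(** There are at least two blocks, so the constant stands in a centered position. *)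
Lemma EG_top_cst Ys c : 0 <= s -> size Ys = size G ->
  EG P G' (rcons Ys (cst c)) = 0 /\
  (stem_finite G Ys -> EG_finite P G' (rcons Ys (cst c))).
Proof.
move=> s0 sY; rewrite EG_finiteE ?size_rcons// (stem_top _ sY).2 EG_stem ?size_rcons//.
rewrite last_blocks_top// Dstar_core; have [f ->] := core_rcons_cst P (last_blocks G Ys) c.
by split => //; rewrite last_blocksE /nilp size_rcons Ex_cst mulr0.
Qed.

Lemma EG_top_stem Ys Z : size Ys = size G ->
  EG_finite P G' (rcons Ys Z) -> stem_finite G Ys.
Proof. by move=> sY; rewrite EG_finiteE ?size_rcons// (stem_top _ sY).2 => -[]. Qed.

End Extension.

Section Minus.
Context (G : pregenogram) (Ys : seq rv) (Y Z : rv).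
Hypotheses (G0 : (0 < size G)%N) (sY : size Ys = (size G).-1).
Let G' : pregenogram := rcons G (size G, -1).

(** An identifier -1 opens no block, so the last two arguments act as a single argument of [G]. *)
Lemma last_blocks_minus :
  last_blocks G' (rcons (rcons Ys Y) Z) = last_blocks G (rcons Ys (fun w => Y w * Z w)).
Proof.
have sYZ : size (rcons Ys Y) = size G by rewrite size_rcons sY prednK.
have qE : qs G' = qs G by rewrite qs_rcons// eqxx /= cats0.
have sE : last_start G' = last_start G by rewrite /last_start qE q0_top.
rewrite !last_blocks_rcons ?size_rcons ?sE//=; last by rewrite -(size_rcons Ys Y) sYZ.
congr rcons; first by rewrite /init_blocks qE q0_top// -/(init_blocks _ _) init_blocks_rcons.
apply/funext => w; have lG := last_start_le G0.
rewrite {1}/block big_nat_recr /=; last by case/andP: lG.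
rewrite nth_rcons sY ltnn eqxx -mulrA; congr (_ * _).
by apply: eq_big_nat => j jab; rewrite nth_rcons ifT// sY; lia.
Qed.

Lemma EG_minus :
  EG P G' (rcons (rcons Ys Y) Z) = EG P G (rcons Ys (fun w => Y w * Z w)) /\
  (EG_finite P G' (rcons (rcons Ys Y) Z) <-> EG_finite P G (rcons Ys (fun w => Y w * Z w))).
Proof.
have sYZ : size (rcons Ys Y) = size G by rewrite size_rcons sY prednK.
rewrite !EG_finiteE ?size_rcons// !EG_stem ?size_rcons// last_blocks_minus.
rewrite (stem_top (-1) G0 Z sYZ).1 (stem_top (-1) G0 Z sYZ).2.
by rewrite /stem /stem_finite !take_q0_rcons// sY.
Qed.

End Minus.

Section Branch.
Context (G : pregenogram) (p : nat) (s : int) (Ys : seq rv) (Z : rv).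
Hypotheses (G0 : (0 < size G)%N) (pG : (0 < p < size G)%N) (sY : size Ys = size G).
Let G' : pregenogram := rcons G (p, s).

(** A parent other than the predecessor starts a new factor whose only block is [Z]; everything
    before it is the stem. *)
Lemma EG_branch : EG P G' (rcons Ys Z) = EG P G Ys * Ex P Z /\
  (EG_finite P G' (rcons Ys Z) <-> EG_finite P G Ys /\ finite_Ex P Z).
Proof.
have ne : (p == size G) = false by lia.
have q0E : q0 G' = (size G).+1 by rewrite q0_rcons// ne.
have qsE : qs G' = [::] by rewrite qs_rcons// ne.
have bE : last_blocks G' (rcons Ys Z) = [:: Z].
  rewrite last_blocks_rcons ?size_rcons// /init_blocks /last_start qsE /= q0E.
  by congr [:: _]; apply/funext => w; rewrite /block big_geq// mul1r.
rewrite EG_finiteE ?size_rcons// EG_stem ?size_rcons// bE /stem /stem_finite q0E /=.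
have -> : ((size G).+1 == 1%N) = false by lia.
rewrite /G' -!cats1 !take_size_cat//; split => //=; split => -[h1 h2]; split => //.
exact: h1.
Qed.

Lemma stem_branch : stem_finite G' Ys <-> EG_finite P G Ys.
Proof.
have ne : (p == size G) = false by lia.
rewrite /stem_finite q0_rcons// ne /= /G' -cats1 take_size_cat// -sY take_size.
by split => // h; apply: h; lia.
Qed.

End Branch.

End Genogram.

(** * Integral form of Taylor expansion *)

Section Calculus.
Context (R : realType).
Local Notation mu := (@lebesgue_measure R).
Implicit Types (f g F : R -> R).

Local Notation I01 := (`[0, 1]%classic : set R).

Lemma integrable_continuous01 f : continuous f -> mu.-integrable I01 (EFin \o f).
Proof.
move=> cf; apply: continuous_compact_integrable; first exact: segment_compact.
exact: continuous_subspaceT.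
Qed.

Lemma Rintegral01_derive F f : continuous f ->
  (forall x, is_derive x (1 : R) F (f x)) ->
  Rintegral mu I01 f = F 1 - F 0.
Proof.
move=> cf dF; rewrite /Rintegral (@continuous_FTC2 R f F 0 1)//.
- exact: continuous_subspaceT.
- have cF x : F @ x --> F x.
    by apply/differentiable_continuous/derivable1_diffP; have [] := dF x.
  split; first by move=> x _; have [] := dF x.
    exact/cvg_at_right_filter.
  exact/cvg_at_left_filter.
- by move=> x _; rewrite derive1E; have [_ ->] := dF x.
Qed.

Lemma continuous_exp n : continuous (fun v : R => v ^+ n).
Proof. exact: exprn_continuous. Qed.

(* Integration by parts against [v ^+ a]; for [a = 0] the first integral
   vanishes and this is the fundamental theorem of calculus. *)
Lemma taylor_integral_step (h : R -> R) (a : nat) (x y : R) :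
  (forall t, derivable h t 1) -> continuous (h^`())%classic ->
  Rintegral mu I01 (fun v => a%:R * v ^+ a.-1 * (h (v * x + (1 - v) * y) - h x))
    + 0 ^+ a * (h y - h x) =
  - (x - y) / a.+1%:R * ((h^`())%classic x +
    Rintegral mu I01 (fun v => a.+1%:R * v ^+ a
                               * ((h^`())%classic (v * x + (1 - v) * y) - (h^`())%classic x))).
Proof.
move=> dh ch'.
pose l (v : R) := v * x + (1 - v) * y.
have dl v : is_derive v (1 : R) l (x - y).
  have -> : l = (fun v => (x - y) *: v + y).
    by apply/funext => w; rewrite /l /GRing.scale/=; ring.
  have d1 : is_derive v (1 : R) ((x - y) \*: (@id R)) ((x - y) *: 1).
    by apply: is_deriveZ.
  have d2 := is_derive_cst (y : R) v (1 : R).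
  have d3 := is_deriveD d1 d2.
  apply: is_derive_eq d3 _.
  by rewrite addr0 /GRing.scale /= mulr1.
have cont F (dF : forall v, derivable F v 1) : continuous F.
  by move=> v; apply/differentiable_continuous/derivable1_diffP.
have cl : continuous l by apply: cont => v; have [] := dl v.
have ch : continuous h by exact: cont.
have chl : continuous (fun v => h (l v)).
  by move=> v; apply: continuous_comp; [exact: cl|exact: ch].
have ch'l : continuous (fun v => (h^`())%classic (l v)).
  by move=> v; apply: continuous_comp; [exact: cl|exact: ch'].
have cc (c : R) : continuous (fun _ : R => c) by move=> v; exact: cvg_cst.
have cX n (c : R) : continuous (fun v : R => c * v ^+ n).
  by move=> v; apply: cvgM; [exact: cvg_cst|exact: continuous_exp].
have cM F g : continuous F -> continuous g -> continuous (fun v => F v * g v).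
  by move=> cF cg v; apply: cvgM; [exact: cF|exact: cg].
have cB F g : continuous F -> continuous g -> continuous (fun v => F v - g v).
  by move=> cF cg v; apply: cvgB; [exact: cF|exact: cg].
have dX n v : is_derive v (1 : R) (fun w : R => w ^+ n) (n%:R * v ^+ n.-1).
  have d := is_deriveX n (is_derive_id v (1 : R)).
  have -> : (fun w : R => w ^+ n) = (@id R) ^+ n by apply/funext => w; rewrite exprfctE.
  by apply: is_derive_eq d _; rewrite /GRing.scale /= mulr1.
have dhl v : is_derive v (1 : R) (fun w => h (l w) - h x) ((x - y) * (h^`())%classic (l v)).
  have d1 : is_derive (l v) (1 : R) h ((h^`())%classic (l v)).
    by rewrite derive1E; exact: derivableP.
  have d2 := is_derive1_comp d1 (dl v).
  have d3 := is_deriveB d2 (is_derive_cst (h x : R) v (1 : R)).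
  by apply: is_derive_eq d3 _; rewrite subr0 mulrC.
set A := fun v => a%:R * v ^+ a.-1 * (h (l v) - h x).
set J := Rintegral _ _ (fun v => a.+1%:R * _ * _).
pose Bf (v : R) := (x - y) * (v ^+ a * (h^`())%classic (l v)).
have cA : continuous A by apply: cM; [exact: cX|exact: cB].
have cXh : continuous (fun v : R => v ^+ a * (h^`())%classic (l v)).
  by apply: cM => //; exact: continuous_exp.
have cBf : continuous Bf by exact: cM.
(* The integrand is the derivative of v^a (h(l v) - h x). This primitive vanishes at v = 1, where l
   v = x, and equals 0^a (h y - h x) at v = 0. *)
have parts : Rintegral mu I01 (fun v => A v + Bf v) = - (0 ^+ a * (h y - h x)).
  have cAB : continuous (fun v => A v + Bf v).
    by move=> v; apply: cvgD; [exact: cA|exact: cBf].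
  have dAB v : is_derive v (1 : R) (fun v => v ^+ a * (h (l v) - h x)) (A v + Bf v).
    have d := is_deriveM (dX a v) (dhl v).
    by apply: is_derive_eq d _; rewrite /A /Bf /GRing.scale /=; ring.
  rewrite (Rintegral01_derive cAB dAB).
  rewrite {1}/l mul1r subrr mul0r addr0 subrr mulr0 sub0r.
  by rewrite /l mul0r add0r subr0 mul1r.
have mI : measurable I01 by exact: measurable_itv.
move: parts; rewrite RintegralD//; try exact: integrable_continuous01.
pose K := Rintegral mu I01 (fun v : R => v ^+ a * (h^`())%classic (l v)).
rewrite /Bf RintegralZl//; last exact: integrable_continuous01.
rewrite -/K => parts.
(* The subtracted constant comes out as h' x because (a+1) v^a has integral 1. *)
have JE : J = a.+1%:R * K - (h^`())%classic x.
  have cK : continuous (fun v : R => (h^`())%classic x * (a.+1%:R * v ^+ a)).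
    exact: cM (cc _) (cX a a.+1%:R).
  have -> : J = Rintegral mu I01
      (fun v => a.+1%:R * (v ^+ a * (h^`())%classic (l v)) - (h^`())%classic x * (a.+1%:R * v ^+ a)).
    by apply: eq_Rintegral => v _; rewrite /l; ring.
  rewrite RintegralB//; first last.
  - by apply: integrable_continuous01.
  - by apply: integrable_continuous01; exact: cM.
  rewrite RintegralZl//; last by apply: integrable_continuous01.
  have dK v : is_derive v (1 : R) (fun v => (h^`())%classic x * v ^+ a.+1)
      ((h^`())%classic x * (a.+1%:R * v ^+ a)) by exact: is_deriveZ (dX a.+1 v).
  congr (_ - _); rewrite (Rintegral01_derive cK dK).
  by rewrite expr1n expr0n /= mulr0 subr0 mulr1.
have a0 : a.+1%:R != 0 :> R by rewrite pnatr_eq0.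
rewrite JE (_ : (h^`())%classic x + _ = a.+1%:R * K); last by ring.
rewrite -/(A) -[Rintegral _ _ _](addrK ((x - y) * K)) parts.
by field.
Qed.

End Calculus.

(** * One-step expansions *)

Section NestedSum.
Context (d : nat) (T : {fset 'rV[int]_d}) (m : nat) (prec : rel 'rV[int]_d).
Local Notation point := 'rV[int]_d.
Local Notation B := (Bset T m prec).
Local Notation D := (Dset T m prec).
Local Notation adm := (admissible T m prec).
Local Notation nsum := (nested_sum T m prec).
Local Opaque Bset Dset.

Lemma admissible_nil G : adm G [::].
Proof. by move=> j; case: j. Qed.

Lemma admissible_rcons G ii i : genogram_spec G -> (size ii < size G)%N ->
  adm G (rcons ii i) <->
  adm G ii /\ i \in (B G ii (size ii).+1 `\` D G ii (size ii).+1)%fset.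
Proof.
move=> hG iiG; rewrite /admissible size_rcons; split=> [h|[h hi]].
  split=> [j /andP[j0 jii]|].
    have := h j; rewrite j0 leqW// => /(_ isT).
    have [-> ->] := BDset_rcons_pts T m prec (j := j) i hG (ltac:(lia)) (leqW jii).
    by rewrite pt_rcons_lt// j0.
  have := h (size ii).+1; rewrite /= leqnn => /(_ isT).
  have [-> ->] := BDset_rcons_pts T m prec (j := (size ii).+1) i hG (ltac:(lia)) (leqnn _).
  by rewrite pt_rcons_last.
move=> j /andP[j0]; rewrite leq_eqVlt ltnS => /predU1P[->|jii].
  have [-> ->] := BDset_rcons_pts T m prec (j := (size ii).+1) i hG (ltac:(lia)) (leqnn _).
  by rewrite pt_rcons_last.
have [-> ->] := BDset_rcons_pts T m prec (j := j) i hG (ltac:(lia)) (leqW jii).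
by rewrite pt_rcons_lt ?j0//; apply: h; rewrite j0.
Qed.

Lemma admissible_ext G x ii : genogram_spec G -> genogram_spec (rcons G x) ->
  (size ii <= size G)%N -> adm (rcons G x) ii <-> adm G ii.
Proof.
move=> hG hG' iiG; split=> h j jii; have := h j jii.
  by have [-> ->] := BDset_rcons_lt T m prec ii (j := j) hG hG' ltac:(lia).
by have [-> ->] := BDset_rcons_lt T m prec ii (j := j) hG hG' ltac:(lia).
Qed.

Section Codomain.
Context (R : realType).
Implicit Types (F : seq point -> R).

Lemma nested_sum_eq G n ii F F' : genogram_spec G -> (size ii + n <= size G)%N ->
  adm G ii ->
  (forall jj, size jj = (size ii + n)%N -> adm G jj -> F jj = F' jj) ->
  nsum G n ii F = nsum G n ii F'.
Proof.
move=> hG; elim: n ii => [|n IH] ii iiG aii h /=; first by apply: h; rewrite ?addn0.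
apply: eq_big_seq => i iBD; apply: IH; first by rewrite size_rcons addSnnS.
  by apply/admissible_rcons => //; lia.
by move=> jj; rewrite size_rcons addSnnS; exact: h.
Qed.

Lemma nested_sum_ext G x n ii F : genogram_spec G -> genogram_spec (rcons G x) ->
  (size ii + n <= size G)%N -> nsum (rcons G x) n ii F = nsum G n ii F.
Proof.
move=> hG hG'; elim: n ii => //= n IH ii iiG.
have [-> ->] := BDset_rcons_lt T m prec ii (j := (size ii).+1) hG hG' ltac:(lia).
by apply: eq_bigr => i _; apply: IH; rewrite size_rcons addSnnS.
Qed.

Lemma nested_sum_rcons G n ii F : nsum G n.+1 ii F =
  nsum G n ii (fun jj => \sum_(i <- (B G jj (size jj).+1 `\` D G jj (size jj).+1)%fset)
                           F (rcons jj i)).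
Proof.
elim: n ii => [//|n IH] ii.
by apply: etrans (eq_bigr _ (fun i _ => IH (rcons ii i))).
Qed.

Lemma nested_sum_lin G n ii (I : Type) (r : seq I) (a : I -> R) (F : I -> seq point -> R) :
  nsum G n ii (fun jj => \sum_(i <- r) a i * F i jj) =
  \sum_(i <- r) a i * nsum G n ii (F i).
Proof.
elim: n ii => [//|n IH] ii /=; rewrite (eq_bigr _ (fun i _ => IH (rcons ii i))).
by rewrite exchange_big; apply: eq_bigr => i _; rewrite mulr_sumr.
Qed.

Lemma nested_sum_eq0 G n ii F j : (size ii < j <= size ii + n)%N ->
  (forall jj, B G jj j = D G jj j) -> nsum G n ii F = 0.
Proof.
move=> + h; elim: n ii => [|n IH] ii jn /=; first lia.
have [E|ne] : j = (size ii).+1 \/ (size ii).+1 <> j by lia.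
  by rewrite -E h fsetDv big_seq_fset0.
by rewrite big1// => i _; apply: IH; rewrite size_rcons; lia.
Qed.

End Codomain.
End NestedSum.

(** * Telescoping of the differences Delta over new vertices *)

Section OneStep.
Context (R : realType) (disp : measure_display) (Omega : measurableType disp)
  (P : probability Omega R) (d : nat) (T : {fset 'rV[int]_d})
  (X : 'rV[int]_d -> {RV P >-> R}) (m : nat) (prec : rel 'rV[int]_d).
Local Notation point := 'rV[int]_d.
Local Notation rv := (Omega -> R).
Local Notation B := (Bset T m prec).
Local Notation D := (Dset T m prec).
Local Notation adm := (admissible T m prec).
Local Notation nsum := (nested_sum T m prec).
Local Notation M := #|` T|.
Local Notation W := (Wset T X).
Local Notation Wt := (Wtot T X).
Local Notation Dch := (Dchain T m prec).
Local Notation Del := (Delta T X m prec).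
Local Opaque Bset Dset.

Lemma Wset_sub (J K : {fset point}) w : (J `<=` K)%fset -> (K `<=` T)%fset ->
  W J w - W K w = (sigma T X)^-1 * \sum_(i <- (K `\` J)%fset) X i w.
Proof.
move=> JK KT; rewrite /Wset -mulrBr; congr (_ * _).
have E : perm_eq (T `\` J)%fset ((T `\` K)%fset ++ (K `\` J)%fset).
  apply: uniq_perm; rewrite ?cat_uniq ?fset_uniq//=.
    by rewrite andbT; apply/hasPn => i; rewrite !inE => /andP[_ ->].
  move=> i; rewrite mem_cat !inE.
  have /implyP := fsubsetP JK i; have /implyP := fsubsetP KT i.
  by case: (i \in K); case: (i \in T); case: (i \in J).
by rewrite (perm_big _ E) big_cat /= addrAC subrr add0r.
Qed.

Lemma Wset0 : W fset0 = Wt.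
Proof. by apply/funext => w; rewrite /Wset fsetD0. Qed.

Lemma WsetT w : W T w = 0.
Proof. by rewrite /Wset fsetDv big_seq_fset0 mulr0. Qed.

Lemma Delta_nonneg G p s f ii : genogram_spec (rcons G (p, s)) -> (0 < size G)%N ->
  0 <= s ->
  Del (rcons G (p, s)) f ii = (fun w =>
    derive1n (size G).-1 f (W (Dch (rcons G (p, s)) ii (size G).+1 (absz s).+1) w) -
    derive1n (size G).-1 f (W (Dch (rcons G (p, s)) ii (size G).+1 (absz s)) w)).
Proof.
move=> hG' G0 s0; apply/funext => w; rewrite /Delta size_rcons.
have nG : (0 < (size G).+1 <= size (rcons G (p, s)))%N by rewrite size_rcons /=.
rewrite uidx_nonneg ?sid_rcons_last// eqxx.
have [||<- <-//] := BDset_Dchain T m prec (G := rcons G (p, s)) ii (c := (size G).+1) (s := absz s) hG'.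
  by rewrite size_rcons; lia.
by rewrite sid_rcons_last gez0_abs.
Qed.

Section Telescoping.
Context (G : pregenogram) (ii : seq point) (u : {fset point} -> R).
Hypothesis hG : genogram_spec G.

(** Vertices of identifier at most 0 can be skipped since they have D_c = D_(g(c)). The others
    telescope along the parents down to the root, where D is empty. *)
Lemma telescope_branch c0 : (0 < c0 <= size G)%N ->
  \sum_(c <- [seq c <- c0 :: anc G c0 | 1 <= sid G c])
     (u (D G ii c) - u (D G ii (gidx G c))) = u (D G ii c0) - u fset0.
Proof.
elim/ltn_ind: c0 => c0 IH cG; have [c1|c1] := leqP c0 1.
  have -> : c0 = 1%N by lia.
  by rewrite anc1//= (gs_sid1 hG) (BDset1 T m prec G ii).2 big_nil subrr.
have cG' : (1 < c0 <= size G)%N by lia.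
have [p0 pc _] := gs_tree hG cG'.
have {}IH := IH _ pc ltac:(lia).
rewrite anc_rec// -cat1s filter_cat big_cat IH /=; case: ifP => s1.
  by rewrite big_cons big_nil addr0 Dset_gidx// addrA subrK.
rewrite big_nil add0r (Dset_rec _ _ _ _ (introT (genogramP _) hG) cG') s1.
by rewrite -Dset_gidx.
Qed.

Lemma telescope_Dchain c n :
  \sum_(s <- iota 0 n) (u (Dch G ii c s.+1) - u (Dch G ii c s)) =
  u (Dch G ii c n) - u (Dch G ii c 0).
Proof.
by have := telescope_sumr (fun s => u (Dch G ii c s)) (leq0n n); rewrite /index_iota subn0.
Qed.

End Telescoping.

Section Expansion.
Context (G : pregenogram) (f : R -> R) (ii : seq point).
Hypotheses (hG : genogram_spec G) (sii : size ii = size G).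
Local Notation n := (size G).
Local Notation h := (derive1n (size G).-1 f).

Lemma sum_Delta_top w :
  \sum_(x <- top_ext M G) Del (rcons G x) f ii w = h 0 - h (W (D G ii n) w).
Proof.
have G0 := gs_size hG.
have gs s : genogram_spec (rcons G (n, s%:Z)).
  apply: (@genogram_nonneg_ext s) => //; rewrite mem_cat; apply/orP; left.
  by apply/top_extP; split => //; lia.
(* The chain does not see the identifier of the new vertex, so the value 0 stands for all. *)
have E s t : Dch (rcons G (n, s%:Z)) ii n.+1 t = Dch (rcons G (n, 0%:Z)) ii n.+1 t.
  by rewrite !Dchain_rcons_top.
rewrite big_map (eq_bigr (fun s =>
   h (W (Dch (rcons G (n, 0%:Z)) ii n.+1 s.+1) w) -
   h (W (Dch (rcons G (n, 0%:Z)) ii n.+1 s) w))); last first.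
  by move=> s _; rewrite (Delta_nonneg f ii (gs s) G0 (le0z_nat s)) !E.
rewrite (telescope_Dchain _ _ (fun J => h (W J w))).
(* The identifiers 0, ..., |T| lead up to member |T| + 1 of the chain, which is all of [T]. There W
   is 0, whence [h 0]. *)
rewrite Dchain_full//; last by rewrite size_rcons; lia.
by rewrite WsetT Dchain_rcons_top.
Qed.

Lemma sum_Delta_branch w :
  \sum_(x <- branch_ext G) Del (rcons G x) f ii w = h (W (D G ii n) w) - h (Wt w).
Proof.
have G0 := gs_size hG; have nG : (0 < n <= n)%N by rewrite G0 /=.
rewrite big_allpairs_dep -Wset0.
rewrite -(telescope_branch ii (fun J => h (W J w)) hG nG).
apply: eq_big_seq => c; rewrite mem_filter => /andP[s1 cc].
have cG : (1 < c <= n)%N.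
  have : (0 < c <= n)%N by move: cc; rewrite inE => /predU1P[->//|/(anc_lt hG nG)]; lia.
  by case: c s1 {cc} => [|[|c]] //; rewrite (gs_sid1 hG).
rewrite (Dchain_sid _ _ _ _ hG cG); last lia.
rewrite -(telescope_Dchain _ _ (fun J => h (W J w)) c).
apply: eq_big_seq => s; rewrite mem_iota => sc.
have hG' : genogram_spec (rcons G (par G c, s%:Z)).
  apply: (@genogram_nonneg_ext 0) => //; rewrite mem_cat; apply/orP; right.
  by apply/branch_extP; exists c; split => //; lia.
by rewrite (Delta_nonneg f ii hG' G0 (le0z_nat s)) !(Dchain_rcons_branch _ _ _ _ hG cG hG').
Qed.

End Expansion.
End OneStep.

(** * Expansion of a T-sum into U-sums of the next order *)

Section Expand.
Context (R : realType) (disp : measure_display) (Omega : measurableType disp)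
  (P : probability Omega R) (d : nat) (T : {fset 'rV[int]_d})
  (X : 'rV[int]_d -> {RV P >-> R}) (m : nat) (prec : rel 'rV[int]_d).
Local Notation point := 'rV[int]_d.
Local Notation rv := (Omega -> R).
Local Notation B := (Bset T m prec).
Local Notation D := (Dset T m prec).
Local Notation adm := (admissible T m prec).
Local Notation nsum := (nested_sum T m prec).
Local Notation M := #|` T|.
Local Notation W := (Wset T X).
Local Notation Wt := (Wtot T X).
Local Notation Del := (Delta T X m prec).
Local Notation Targs := (T_args T X m prec).
Local Notation Uargs := (U_args T X m prec).
Local Opaque Bset Dset.

(** Only the sign of an identifier enters the blocks. All top extensions can thus be read in one
    genogram, where linearity in the last argument applies. *)
Lemma EG_top_indep (G : pregenogram) (s t : int) (Ys : seq rv) (Z : rv) :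
  (0 < size G)%N -> 0 <= s -> 0 <= t -> size Ys = size G ->
  EG P (rcons G (size G, s)) (rcons Ys Z) = EG P (rcons G (size G, t)) (rcons Ys Z) /\
  (EG_finite P (rcons G (size G, s)) (rcons Ys Z) <->
   EG_finite P (rcons G (size G, t)) (rcons Ys Z)).
Proof.
move=> G0 s0 t0 sY; rewrite !EG_finiteE ?size_rcons// !EG_stem ?size_rcons//.
rewrite !last_blocks_top// (stem_top P s G0 Z sY).1 (stem_top P t G0 Z sY).1.
by rewrite (stem_top P s G0 Z sY).2 (stem_top P t G0 Z sY).2.
Qed.

Lemma size_XS (ii : seq point) : size (XS X ii) = size ii.
Proof. by rewrite size_map. Qed.

Lemma XS_rcons (ii : seq point) i : XS X (rcons ii i) = rcons (XS X ii) (X i : rv).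
Proof. by rewrite /XS map_rcons. Qed.

Section TExpand.
Context (G : pregenogram) (f : R -> R).
Hypothesis hG : genogram_spec G.
Local Notation n := (size G).
Local Notation h := (derive1n (size G).-1 f).

Let G0 : (0 < n)%N := gs_size hG.

Lemma EG_T_expand (ii : seq point) : size ii = n ->
  EG_finite P G (XS X ii) ->
  finite_Ex P (fun w => h (Wt w)) ->
  (forall x, x \in nonneg_ext M G -> EG_finite P (rcons G x) (Uargs (rcons G x) f ii)) ->
  EG_finite P G (Targs G f ii) /\
  EG P G (Targs G f ii) = EG P G (XS X ii) * Ex P (fun w => h (Wt w))
    - \sum_(x <- top_ext M G) EG P (rcons G x) (Uargs (rcons G x) f ii)
    + \sum_(x <- branch_ext G) EG P (rcons G x) (Uargs (rcons G x) f ii).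
Proof.
move=> sii; case: (lastP ii) sii => {ii} [/= E|jj i]; first by have := G0; rewrite -E.
rewrite size_rcons => sjj; set ii := rcons jj i => Sfin Wfin Ufin.
have sii : size ii = n by rewrite /ii size_rcons.
have sY : size (XS X jj) = n.-1 by rewrite size_XS -sjj.
have sYi : size (XS X ii) = n by rewrite size_XS.
pose F : rv := fun w => h (W (D G ii n) w).
have tE : take n.-1 ii = jj by rewrite -sjj /ii -cats1 take_size_cat.
have pE : pt ii n = i by rewrite -sjj pt_rcons_last.
have TE : Targs G f ii = rcons (XS X jj) (fun w => X i w * F w) by rewrite /T_args tE pE.
have gs s : 0 <= s <= M%:Z -> (n, s) \in nonneg_ext M G.
  by move=> sM; rewrite mem_cat; apply/orP; left; apply/top_extP.
have Ut s : 0 <= s <= M%:Z ->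
    EG_finite P (rcons G (n, 0%:Z)) (Uargs (rcons G (n, s)) f ii).
  move=> sM; rewrite /U_args (EG_top_indep (t := s) _ G0 _ _ sYi).2//; last by case/andP: sM.
  by apply: Ufin; exact: gs.
have sf : stem_finite P G (XS X ii).
  by apply: (EG_top_stem (s := 0%:Z) G0 sYi); apply: (Ut 0); rewrite lexx.
pose G' := rcons G (n, 0%:Z).
have G'0 : (0 < size G')%N by rewrite size_rcons.
have sYi' : size (XS X ii) = (size G').-1 by rewrite size_rcons.
have sf' : stem_finite P G' (XS X ii).
  by rewrite /G' /stem_finite q0_top// -cats1 takel_cat//; have := q0_bounds G0; lia.
have topE : EG_finite P G' (rcons (XS X ii) F) /\ EG P G' (rcons (XS X ii) F) =
    - \sum_(x <- top_ext M G) EG P (rcons G x) (Uargs (rcons G x) f ii).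
  (* [None] stands for the constant [h 0], which makes [F] one finite linear combination; the
     operator kills this term. *)
  pose r := None :: [seq Some x | x <- top_ext M G].
  pose a (o : option (nat * int)) : R := if o is Some x then -1 else 1.
  pose Z (o : option (nat * int)) : rv :=
    if o is Some x then Del (rcons G x) f ii else cst (h 0).
  have Zfin o : o \in r -> EG_finite P G' (rcons (XS X ii) (Z o)).
    rewrite inE => /predU1P[->|/mapP[[p s] + ->]] /=.
      by have [_] := EG_top_cst P G0 (h 0) (s := 0%:Z) isT sYi; apply.
    by move=> /top_extP[-> sM]; exact: Ut.
  have FE : F = (fun w => \sum_(o <- r) a o * Z o w).
    apply/funext => w; rewrite big_cons big_map /= mul1r.
    under eq_bigr do rewrite mulN1r.
    by rewrite sumrN (@sum_Delta_top _ _ _ P) // opprB addrC subrK.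
  have [f1 f2] := EG_rcons_sum G'0 sYi' a sf' Zfin.
  rewrite FE; split => //; rewrite f2 big_cons big_map /=.
  have [-> _] := EG_top_cst P G0 (h 0) (s := 0%:Z) isT sYi.
  rewrite mulr0 add0r -sumrN; apply: eq_big_seq => -[p s] /top_extP[-> sM].
  by rewrite mulN1r /U_args (EG_top_indep (t := s) _ G0 _ _ sYi).1//; case/andP: sM.
have branchE x : x \in branch_ext G ->
    finite_Ex P (Del (rcons G x) f ii) /\
    EG P (rcons G x) (Uargs (rcons G x) f ii) =
    EG P G (XS X ii) * Ex P (Del (rcons G x) f ii).
  move=> xb; have xn : x \in nonneg_ext M G by rewrite mem_cat xb orbT.
  case: x xb xn => p s xb xn; have [pn _] := branch_ext_par hG xb.
  have [E1 E2] := EG_branch P s (Del (rcons G (p, s)) f ii) G0 pn sYi.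
  by split; [have /E2[] := Ufin _ xn|rewrite -E1].
(* Here [None] carries f^(n-1)(W), to which the branch differences add up to [F]. *)
have ExF : Ex P F = Ex P (fun w => h (Wt w))
    + \sum_(x <- branch_ext G) Ex P (Del (rcons G x) f ii).
  pose r := None :: [seq Some x | x <- branch_ext G].
  pose Z (o : option (nat * int)) : rv :=
    if o is Some x then Del (rcons G x) f ii else (fun w => h (Wt w)).
  have Zfin o : o \in r -> finite_Ex P (Z o).
    by rewrite inE => /predU1P[->//|/mapP[x xb ->]] /=; have [] := branchE _ xb.
  have [_] := Ex_sum (fun _ => 1) Zfin.
  rewrite big_cons big_map mul1r /=.
  under [in X in _ + X]eq_bigr do rewrite mul1r.
  move=> <-; congr Ex; apply/funext => w; rewrite big_cons big_map /= mul1r.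
  under eq_bigr do rewrite mul1r.
  by rewrite (@sum_Delta_branch _ _ _ P)// addrC subrK.
have XE : XS X ii = rcons (XS X jj) (X i : rv) by rewrite XS_rcons.
have [topF topEE] := topE; rewrite XE in topF topEE Sfin.
have [f1 f2] := EG_top (s := 0%:Z) G0 isT sY topF Sfin.
rewrite TE; split => //; rewrite f2 topEE ExF -XE mulrDr addrAC; congr (_ - _ + _).
rewrite mulr_sumr; apply: eq_big_seq => x xb.
by have [_ ->] := branchE _ xb.
Qed.

(** The sign of b for a single step; b of a longer extension is a of its predecessor times this
    sign. *)
Definition ext_sign (x : nat * int) : R :=
  (-1) ^ ((leaves (rcons G x))%:Z - (leaves G)%:Z
          + (minus_ones (rcons G x))%:Z - (minus_ones G)%:Z + 1).

Lemma ext_sign_top x : x \in top_ext M G -> ext_sign x = -1.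
Proof.
case: x => p s /top_extP[-> sM]; rewrite /ext_sign leaves_rcons_top// minus_ones_rcons//.
have -> : (s == -1) = false by lia.
by rewrite addn0 subrr add0r subrr add0r expr1z.
Qed.

Lemma ext_sign_branch x : x \in branch_ext G -> ext_sign x = 1.
Proof.
case: x => p s xb; rewrite /ext_sign leaves_rcons_branch// minus_ones_rcons//.
have -> : (s == -1) = false by case/branch_extP: xb => c [_ _]; lia.
rewrite addn0.
have -> : (leaves G).+1%:Z - (leaves G)%:Z + (minus_ones G)%:Z - (minus_ones G)%:Z + 1 = 2 by lia.
by rewrite -exprnP sqrrN expr1n.
Qed.

Lemma ext_sign_minus : ext_sign (n, -1) = 1.
Proof.
rewrite /ext_sign leaves_rcons_top// minus_ones_rcons// eqxx.
have -> : (leaves G)%:Z - (leaves G)%:Z + (minus_ones G + true)%N%:Z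
  - (minus_ones G)%:Z + 1 = 2 by lia.
by rewrite -exprnP sqrrN expr1n.
Qed.

Lemma calT_expand :
  S_finite T X m prec G -> finite_Ex P (fun w => h (Wt w)) ->
  (forall x, x \in nonneg_ext M G -> U_finite T X m prec (rcons G x) f) ->
  T_finite T X m prec G f /\
  calT T X m prec G f = calS T X m prec G * Ex P (fun w => h (Wt w))
    + \sum_(x <- nonneg_ext M G) ext_sign x * calU T X m prec (rcons G x) f.
Proof.
move=> Sfin Wfin Ufin.
have key ii (sii : size ii = n) (aii : adm G ii) := EG_T_expand sii (Sfin ii sii aii) Wfin
  (fun x xn => Ufin x xn ii (etrans sii (esym (congr1 predn (size_rcons G x))))
     ((admissible_ext T m prec hG (genogram_nonneg_ext hG xn) (eq_leq sii)).2 aii)).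
split; first by move=> ii sii aii; have [] := key ii sii aii.
rewrite /calT (@nested_sum_eq _ T m prec R G n [::] _ (fun ii =>
   \sum_(o <- None :: [seq Some x | x <- nonneg_ext M G])
     (if o is Some x then ext_sign x else Ex P (fun w => h (Wt w))) *
     (if o is Some x then EG P (rcons G x) (Uargs (rcons G x) f ii)
      else EG P G (XS X ii)))) //; first last.
- move=> ii sii aii; have [_ ->] := key ii sii aii.
  rewrite [RHS]big_cons [X in _ = _ + X]big_map [X in _ = _ + X]big_cat /=.
  rewrite mulrC -addrA -sumrN; congr (_ + (_ + _)); apply: eq_big_seq => x xb.
    by rewrite ext_sign_top// mulN1r.
  by rewrite ext_sign_branch// mul1r.
- exact: admissible_nil.
rewrite (nested_sum_lin T m prec G n [::] _ _ (fun o ii =>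
  if o is Some x then EG P (rcons G x) (Uargs (rcons G x) f ii)
  else EG P G (XS X ii))).
rewrite big_cons big_map mulrDr /calS; congr (_ + _); first by rewrite mulrCA mulrC.
rewrite mulr_sumr; apply: eq_big_seq => x xn.
have hx := genogram_nonneg_ext hG xn; rewrite mulrCA; congr (_ * _).
rewrite /calU size_rcons -[n.+1.-1]/n; congr (_ * _).
by rewrite (nested_sum_ext T m prec _ hG hx).
Qed.

End TExpand.
End Expand.

(** * Integration by parts in a U-sum *)

Section UExpand.
Context (R : realType) (disp : measure_display) (Omega : measurableType disp)
  (P : probability Omega R) (d : nat) (T : {fset 'rV[int]_d})
  (X : 'rV[int]_d -> {RV P >-> R}) (m : nat) (prec : rel 'rV[int]_d).
Local Notation point := 'rV[int]_d.
Local Notation rv := (Omega -> R).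
Local Notation B := (Bset T m prec).
Local Notation D := (Dset T m prec).
Local Notation adm := (admissible T m prec).
Local Notation nsum := (nested_sum T m prec).
Local Notation W := (Wset T X).
Local Notation Del := (Delta T X m prec).
Local Notation Targs := (T_args T X m prec).
Local Notation Uargs := (U_args T X m prec).
Local Notation sg := (sigma T X).
Local Opaque Bset Dset.

Context (G : pregenogram) (f : R -> R).
Hypotheses (hG : genogram_spec G) (G1 : (1 < size G)%N).
Hypothesis fC : class_C (size G).-1 f.
Local Notation n := (size G).
Local Notation G' := (rcons G (size G, -1 : int)).
Local Notation h' := (derive1n (size G).-1 f).

Let G0 : (0 < n)%N := gs_size hG.

Let hG' : genogram_spec G'.
Proof. by apply: (@genogram_one_ext 0) => //; exact: mem_head. Qed.

(** The factor with j = n in the products of a and b; it is the 1/(a+1) of [taylor_integral_step]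
    with a = n - u(n). *)
Definition taylor_coef : R := ((n.+1 - uidx G n)%:R)^-1.

(** The integral [delta] involves only the sets B and D inherited from v[n], which are fixed before
    i_n is chosen. Being free of [i], it factors out of the sum over i_n. *)
Lemma Delta_minus (jj : seq point) w : size jj = n.-1 ->
  exists2 delta : R, (forall i, Del G' f (rcons jj i) w = delta) &
  Del G f jj w = - (W (D G jj n) w - W (B G jj n) w) * taylor_coef *
    (h' (W (D G jj n) w) + delta).
Proof.
move=> sjj.
have nG : (0 < n <= n)%N by rewrite G0 /=.
have nG' : (1 < n.+1 <= size G')%N by rewrite size_rcons; lia.
have /andP[u0 un] := uidx_le hG nG.
have uE : uidx G' n.+1 = uidx G n.
  by rewrite (uidx_neg hG') ?sid_rcons_last ?par_rcons_last// uidx_rcons_lt.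
have szjj : (n <= (size jj).+1)%N by rewrite sjj prednK.
have BE i : B G' (rcons jj i) n.+1 = B G jj n.
  rewrite (Bset_rec _ _ _ _ (introT (genogramP _) hG') nG') sid_rcons_last uE.
  have [-> _] := BDset_rcons_lt T m prec (rcons jj i) (j := uidx G n) hG hG' ltac:(lia).
  have [-> _] := BDset_rcons_pts T m prec i (j := uidx G n) hG ltac:(lia) (leq_trans un szjj).
  have [s0|s0] := leP 0 (sid G n); first by rewrite uidx_nonneg.
  have n1 : (1 < n <= n)%N by rewrite G1 /=.
  by rewrite [RHS](Bset_rec _ _ _ _ (introT (genogramP _) hG) n1) leNgt s0.
have DE i : D G' (rcons jj i) n.+1 = D G jj n.
  rewrite (Dset_rec _ _ _ _ (introT (genogramP _) hG') nG') sid_rcons_last.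
  rewrite (Dset_gidx _ _ _ _ hG' nG') par_rcons_last.
  have [_ ->] := BDset_rcons_lt T m prec (rcons jj i) hG hG' nG.
  by have [_ ->] := BDset_rcons_pts T m prec i hG nG szjj.
set x := W (D G jj n) w; set y := W (B G jj n) w; pose a := (n - uidx G n)%N.
pose h := derive1n n.-2 f.
have h'E : h' = derive1 h.
  by rewrite /h -derive1nS; congr (derive1n _ f); lia.
have dh t : derivable h t 1 by have [dh _] := fC; apply: dh; lia.
have ch' : continuous (derive1 h) by rewrite -h'E; have [_] := fC.
have aE : a.+1 = (n.+1 - uidx G n)%N by rewrite /a subSn.
exists (Rintegral (@lebesgue_measure R) `[0, 1] (fun v =>
    a.+1%:R * v ^+ a * (h' (v * x + (1 - v) * y) - h' x))).
  move=> i; rewrite /Delta size_rcons uE BE DE -/x -/y -aE.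
  by have -> : (uidx G n == n.+1) = false by lia.
have -> : taylor_coef = a.+1%:R^-1 by rewrite /taylor_coef aE.
have := taylor_integral_step a x y dh ch'; rewrite -h'E => <-.
(* If u(n) = n, then a = 0: the integral vanishes and [0 ^+ 0 = 1] leaves the plain difference.
   Otherwise [0 ^+ a = 0] leaves the weighted integral. *)
rewrite /Delta; case: eqP => [uE'|uE'].
  have -> : a = 0%N by rewrite /a uE' subnn.
  rewrite expr0 mul1r (_ : Rintegral _ _ _ = 0) ?add0r//.
  rewrite (@eq_Rintegral _ _ _ _ _ (cst 0)); first by rewrite /Rintegral integral0.
  by move=> v _; rewrite !mul0r.
rewrite expr0n (_ : (a == 0)%N = false) ?mul0r ?addr0; last by rewrite /a; lia.
by have -> : (n.-1 - uidx G n = a.-1)%N by rewrite /a; lia.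
Qed.

(** The increment W(D_n) - W(B_n) is the sum of X_i / sigma over B_n \ D_n, and identifier -1 lets
    X_i and its Delta be one argument of [G]. The stem is assumed finite because that index set may
    be empty. *)
Lemma EG_U_expand (jj : seq point) : size jj = n.-1 -> adm G jj ->
  stem_finite P G (XS X jj) ->
  (forall i, i \in (B G jj n `\` D G jj n)%fset ->
     EG_finite P G (Targs G f (rcons jj i)) /\
     EG_finite P G' (Uargs G' f (rcons jj i))) ->
  EG_finite P G (Uargs G f jj) /\
  EG P G (Uargs G f jj) = \sum_(i <- (B G jj n `\` D G jj n)%fset)
    - taylor_coef * sg^-1 *
      (EG P G (Targs G f (rcons jj i)) + EG P G' (Uargs G' f (rcons jj i))).
Proof.
move=> sjj ajj sf fin; set L := (B G jj n `\` D G jj n)%fset.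
have sY : size (XS X jj) = n.-1 by rewrite size_XS.
have szjj : (n <= (size jj).+1)%N by rewrite sjj prednK.
have nG : (0 < n <= n)%N by rewrite G0 /=.
have /andP[DB BT] := BDset_sub T m prec jj hG nG.
have TE i : Targs G f (rcons jj i) =
    rcons (XS X jj) (fun w => X i w * h' (W (D G jj n) w)).
  have tE : take n.-1 (rcons jj i) = jj by rewrite -sjj -cats1 take_size_cat.
  have pE : pt (rcons jj i) n = i by rewrite -(prednK G0) -sjj pt_rcons_last.
  by rewrite /T_args tE pE; have [_ ->] := BDset_rcons_pts T m prec i hG nG szjj.
(* [true] marks the T-terms and [false] the U-terms of the extension by -1. *)
pose Z (o : bool * point) : rv := if o.1
  then fun w => X o.2 w * h' (W (D G jj n) w)
  else fun w => X o.2 w * Del G' f (rcons jj o.2) w.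
have UE i : Uargs G' f (rcons jj i) = rcons (rcons (XS X jj) (X i : rv)) (Del G' f (rcons jj i)).
  by rewrite /U_args XS_rcons.
pose r := [seq (true, i) | i <- L] ++ [seq (false, i) | i <- L].
have Zfin o : o \in r -> EG_finite P G (rcons (XS X jj) (Z o)).
  rewrite mem_cat => /orP[]/mapP[i iL ->] /=; have [f1 f2] := fin i iL.
    by rewrite -TE.
  by apply/(EG_minus P (X i : rv) _ G0 sY).2; rewrite -UE.
have [] := EG_rcons_sum G0 sY (fun _ => - taylor_coef * sg^-1) sf Zfin.
have -> : (fun w => \sum_(o <- r) - taylor_coef * sg^-1 * Z o w) = Del G f jj.
  apply/funext => w; rewrite big_cat !big_map /= -big_split /=.
  have [delta dE ->] := Delta_minus w sjj.
  rewrite Wset_sub// -/L.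
  rewrite (eq_bigr (fun i => - taylor_coef * sg^-1 * (h' (W (D G jj n) w) + delta)
    * X i w)); last by move=> i _; rewrite /Z /= dE; ring.
  by rewrite -mulr_sumr; ring.
move=> f1 f2; split => //; rewrite f2 big_cat !big_map /= -big_split /=.
apply: eq_bigr => i _; rewrite TE UE mulrDr; congr (_ + _ * _).
exact/esym/(EG_minus P (X i : rv) _ G0 sY).1.
Qed.

Lemma calU_expand :
  (forall jj, size jj = n.-1 -> adm G jj -> stem_finite P G (XS X jj)) ->
  T_finite T X m prec G f -> U_finite T X m prec G' f ->
  U_finite T X m prec G f /\
  calU T X m prec G f =
    - taylor_coef * (calT T X m prec G f + calU T X m prec G' f).
Proof.
move=> sf Tfin Ufin.
have nE : n = n.-1.+1 by rewrite prednK.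
have fin jj i : size jj = n.-1 -> adm G jj -> i \in (B G jj n `\` D G jj n)%fset ->
     EG_finite P G (Targs G f (rcons jj i)) /\
     EG_finite P G' (Uargs G' f (rcons jj i)).
  move=> sjj ajj iL; have si : size (rcons jj i) = n by rewrite size_rcons sjj -nE.
  have ai : adm G (rcons jj i).
    have lt : (size jj < n)%N by rewrite sjj; lia.
    by apply: (admissible_rcons T m prec i hG lt).2; rewrite sjj -nE.
  split; first exact: Tfin.
  apply: Ufin; first by rewrite si size_rcons.
  by apply/(admissible_ext T m prec hG hG'); rewrite ?si.
have key jj sjj ajj := EG_U_expand sjj ajj (sf jj sjj ajj) (fun i => @fin jj i sjj ajj).
split; first by move=> jj sjj ajj; have [] := key jj sjj ajj.
pose Ft jj := \sum_(i <- (B G jj (size jj).+1 `\` D G jj (size jj).+1)%fset)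
   EG P G (Targs G f (rcons jj i)).
pose Fu jj := \sum_(i <- (B G jj (size jj).+1 `\` D G jj (size jj).+1)%fset)
   EG P G' (Uargs G' f (rcons jj i)).
have -> : calT T X m prec G f = sg ^- n * nsum G n.-1 [::] Ft.
  by rewrite /calT {2}nE nested_sum_rcons.
have -> : calU T X m prec G' f = sg ^- n * nsum G n.-1 [::] Fu.
  rewrite /calU size_rcons -[n.+1.-1]/n (nested_sum_ext T m prec _ hG hG')//.
  by rewrite {2}nE nested_sum_rcons.
rewrite /calU (@nested_sum_eq _ T m prec R G n.-1 [::] _ (fun jj =>
   \sum_(b <- [:: true; false]) - taylor_coef * sg^-1 * (if b then Ft jj else Fu jj))) //.
- rewrite (nested_sum_lin T m prec G n.-1 [::] _ _ (fun (b : bool) jj => if b then Ft jj else Fu jj)).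
  rewrite !big_cons big_nil addr0 /= -mulrDr -mulrDr.
  (* The factor 1/sigma from the increment raises the power from n - 1 to n. *)
  rewrite [in RHS]nE exprS invfM; ring.
- by rewrite add0n leq_pred.
- exact: admissible_nil.
move=> jj sjj ajj; have [_ ->] := key jj sjj ajj.
rewrite !big_cons big_nil addr0 /= -mulrDr -mulr_sumr /Ft /Fu sjj -nE.
by rewrite big_split.
Qed.

End UExpand.

(** * Iteration *)

Section Levels.
Context (M : nat) (G : pregenogram).

(* [i = 0] is the step where the theorem requires [s_(|G|+1) >= 0].  Identifiers
   above [M = #|T|] contribute nothing, so the lists [level i] are exhaustive. *)
Definition next_ext (i : nat) (H : pregenogram) : seq (nat * int) :=
  if i is 0%N then nonneg_ext M H else one_ext M H.

Fixpoint level (i : nat) : seq pregenogram :=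
  if i is i'.+1 then [seq rcons H x | H <- level i', x <- next_ext i' H]
  else [:: G].

Hypothesis hG : genogram_spec G.

Record level_spec (i : nat) (H : pregenogram) : Prop := LevelSpec {
  lv_genogram : genogram_spec H;
  lv_size : size H = (size G + i)%N;
  lv_take : take (size G) H = G;
  lv_sid : (0 < i)%N -> 0 <= sid H (size G).+1
}.

Lemma next_extP i H x : level_spec i H -> x \in next_ext i H ->
  level_spec i.+1 (rcons H x).
Proof.
move=> [hH sH tH dH] xn; have G0 := gs_size hG; split.
- by case: i sH dH xn => [|i] sH _; [exact: genogram_nonneg_ext|apply: genogram_one_ext => //; lia].
- by rewrite size_rcons sH addnS.
- by rewrite -cats1 takel_cat// sH leq_addr.
move=> _; case: x xn => p s; case: i sH dH => [|i] sH dH xn; last first.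
  by rewrite sid_rcons_lt ?dH ?sH//; lia.
move: sH; rewrite addn0 => <-; rewrite sid_rcons_last.
by move: xn; rewrite mem_cat => /orP[/top_extP[]|/branch_extP[c []]]; lia.
Qed.

Lemma levelP i H : H \in level i -> level_spec i H.
Proof.
elim: i H => [|i IH] H /=.
  by rewrite inE => /eqP->; split; rewrite ?addn0 ?take_size.
by case/allpairsPdep => K [x [/IH hK xn ->]]; exact: next_extP.
Qed.

Lemma level_uniq i : uniq (level i).
Proof.
elim: i => //= i IH; apply: allpairs_uniq_dep => //.
  move=> H /levelP[hH _ _ _]; case: i {IH} => [|i] /=.
    exact: uniq_nonneg_ext.
  exact: uniq_one_ext.
by move=> [H x] [K y] _ _ /= /rcons_inj[-> ->].
Qed.

Lemma level_complete i H : level_spec i H ->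
  (forall j, (size G < j <= size H)%N -> sid H j <= M%:Z) -> H \in level i.
Proof.
have G0 := gs_size hG.
elim: i H => [|i IH] H [hH sH tH dH] bd.
  by rewrite inE -tH take_oversize// sH addn0.
case: (lastP H) hH sH tH dH bd => [|K x] hH sH tH dH bd; first by move: sH => /=; lia.
have sK : size K = (size G + i)%N by move: sH; rewrite size_rcons; lia.
have K0 : (0 < size K)%N by lia.
have KE : K = take (size K) (rcons K x) by rewrite -cats1 take_size_cat.
have hK : genogram_spec K by rewrite KE; exact: genogram_take.
case: x KE hH sH tH dH bd => p s KE hH sH tH dH bd.
have bdK j : (size G < j <= size K)%N -> sid K j <= M%:Z.
  by move=> jK; rewrite -(sid_rcons_lt p s K0); [apply: bd; rewrite size_rcons|]; lia.
have lK : level_spec i K.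
  split => //; first by rewrite -[RHS]tH -cats1 takel_cat// sK leq_addr.
  by move=> i0; rewrite -(sid_rcons_lt p s K0); [exact: dH|lia].
have sM : s <= M%:Z.
  have := bd (size K).+1; rewrite sid_rcons_last; apply; rewrite size_rcons; lia.
apply/allpairsPdep; exists K, (p, s); split => //; first exact: IH.
(* Identifier -1 is missing only from the first step, where it would contradict the sign required of
   s_(|G|+1). *)
have := mem_one_ext hK hH sM; case: i {IH lK} sK dH sH => //= sK dH sH.
rewrite inE => /predU1P[[_ s1]|//]; have := dH isT.
by rewrite (_ : size G = size K) ?sid_rcons_last ?s1//; lia.
Qed.

End Levels.

(** * Coefficients, induction on the depth, and sums over genograms *)

Section Main.
Context (R : realType) (disp : measure_display) (Omega : measurableType disp)
  (P : probability Omega R) (d : nat) (T : {fset 'rV[int]_d})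
  (X : 'rV[int]_d -> {RV P >-> R}) (m : nat) (prec : rel 'rV[int]_d).
Local Notation point := 'rV[int]_d.
Local Notation M := #|` T|.
Local Notation Wt := (Wtot T X).
Local Notation calS := (calS T X m prec).
Local Notation calT := (calT T X m prec).
Local Notation calU := (calU T X m prec).

Definition pre_sgn (H G : pregenogram) : int :=
  (leaves H)%:Z - (leaves G)%:Z + (minus_ones H)%:Z - (minus_ones G)%:Z.

(** For H = G the exponent is 0 and the product empty, so the formula gives 1 without a case
    distinction. *)
Definition pre_a (H G : pregenogram) : R :=
  (-1) ^ (pre_sgn H G) *
    \prod_((size G).+1 <= j < (size H).+1) ((j.+1 - uidx H j)%:R)^-1.

Definition pre_b (H G : pregenogram) : R :=
  (-1) ^ (pre_sgn H G + 1) *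
    \prod_((size G).+1 <= j < size H) ((j.+1 - uidx H j)%:R)^-1.

Lemma pre_a_refl G : pre_a G G = 1.
Proof. by rewrite /pre_a /pre_sgn big_geq// subrr add0r subrr expr0z mulr1. Qed.

(** The last factor of the product in a is absent from b; with a change of sign it is what one
    integration by parts contributes. *)
Lemma pre_aE H G : (size G < size H)%N ->
  pre_a H G = pre_b H G * - taylor_coef R H.
Proof.
move=> GH; rewrite /pre_a /pre_b big_nat_recr //= -/(taylor_coef R H).
rewrite [in RHS](expfzDr (pre_sgn H G) 1) ?oppr_eq0 ?oner_neq0// expr1z.
by move: (_ ^ _) => e; ring.
Qed.

(** The exponents add up along G, H, [rcons H x], and the new vertex does not enter the product in
    b. *)
Lemma pre_b_rcons H G x : genogram_spec H -> (size G <= size H)%N ->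
  pre_b (rcons H x) G = pre_a H G * ext_sign R H x.
Proof.
move=> hH GH; rewrite /pre_b /pre_a /ext_sign size_rcons.
have -> : pre_sgn (rcons H x) G + 1 = pre_sgn H G + (pre_sgn (rcons H x) H + 1).
  by rewrite /pre_sgn; ring.
rewrite (expfzDr (pre_sgn H G)) ?oppr_eq0 ?oner_neq0// -/(pre_sgn _ _) mulrAC; congr (_ * _ * _).
by apply: eq_big_nat => j jH; rewrite uidx_rcons_lt//; lia.
Qed.

(** The stem of the extension is that of [H] if the new vertex hangs below the last one, and all of
    [H] otherwise. *)
Lemma stem_finite_rcons (H : pregenogram) p s (Ys : seq (Omega -> R)) :
  (0 < p <= size H)%N -> size Ys = size H -> EG_finite P H Ys ->
  stem_finite P (rcons H (p, s)) Ys.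
Proof.
move=> pH sY fY; have H0 : (0 < size H)%N by lia.
have [->|ne] := eqVneq p (size H); last by apply/stem_branch => //; lia.
move/(EG_finiteE P Ys H0): fY => -[sf _].
rewrite /stem_finite q0_top// -cats1 takel_cat//.
by have := q0_bounds H0; lia.
Qed.

Section Induction.
Context (G : pregenogram) (f : R -> R).
Hypothesis hG : genogram_spec G.
Local Notation EW H := (Ex P (fun w => derive1n (size H).-1 f (Wt w))).
Local Notation level := (level M G).

(** Integration by parts followed by the expansion of the resulting T-sum; the extension by -1 joins
    the nonnegative ones with sign 1. *)
Lemma calU_step i H : H \in level i.+1 -> class_C (size H).-1 f ->
  S_finite T X m prec H -> (forall K, K \in level i -> S_finite T X m prec K) ->
  finite_Ex P (fun w => derive1n (size H).-1 f (Wt w)) ->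
  (forall x, x \in one_ext M H -> U_finite T X m prec (rcons H x) f) ->
  U_finite T X m prec H f /\
  calU H f = - taylor_coef R H * (calS H * EW H
    + \sum_(x <- one_ext M H) ext_sign R H x * calU (rcons H x) f).
Proof.
move=> Hl fC Sfin SfinK Wfin Ufin; have [hH sH _ _] := levelP hG Hl.
have G0 := gs_size hG.
have [|Tfin TE] := calT_expand (X := X) (m := m) (prec := prec) (f := f) hH Sfin Wfin.
  by move=> x xn; apply: Ufin; rewrite inE xn orbT.
have H1 : (1 < size H)%N by rewrite sH; lia.
(* Finiteness of the stem is drawn from the S-term of the predecessor [K], whose arguments are
   exactly the given ones. *)
have sf jj : size jj = (size H).-1 -> admissible T m prec H jj ->
    stem_finite P H (XS X jj).
  move: Hl => /allpairsPdep[K [[p s] [Kl xn HE]]]; move: hH; rewrite HE => hH' sjj ajj.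
  have [hK sK _ _] := levelP hG Kl.
  have [pK _ _ _ _] := (genogram_rconsP _ _ hK).1 hH'.
  rewrite size_rcons /= in sjj.
  apply: stem_finite_rcons => //; first by rewrite size_XS.
  by apply: (SfinK K Kl) => //; apply/(admissible_ext T m prec hK hH'); rewrite ?sjj.
have [f1 f2] := calU_expand hH H1 fC sf Tfin (Ufin _ (mem_head _ _)).
split => //; rewrite f2 TE [in RHS]big_cons ext_sign_minus// mul1r; congr (_ * _).
by rewrite -addrA; congr (_ + _); rewrite addrC.
Qed.

(** In the induction, the U-terms of the last level turn into S-terms of that level, which prolong
    the first sum, and U-terms of the next level. *)
Lemma calT_levels i : class_C (size G + i).-1 f ->
  (forall j H, (j <= i)%N -> H \in level j -> S_finite T X m prec H) ->
  (forall j H, (j <= i)%N -> H \in level j ->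
     finite_Ex P (fun w => derive1n (size H).-1 f (Wt w))) ->
  (forall H, H \in level i.+1 -> U_finite T X m prec H f) ->
  calT G f =
    \sum_(j <- iota 0 i.+1) \sum_(H <- level j) pre_a H G * (calS H * EW H)
    + \sum_(H <- level i.+1) pre_b H G * calU H f.
Proof.
elim: i => [|i IH] fC Sfin Wfin Ufin.
  have hl : G \in level 0 by rewrite inE.
  have [|_ ->] := calT_expand (X := X) (m := m) (prec := prec) (f := f) hG
    (Sfin 0%N G isT hl) (Wfin 0%N G isT hl).
    move=> x xn; apply: Ufin; apply/allpairsPdep.
    by exists G, x.
  rewrite big_seq1 [level 0]/= big_seq1 pre_a_refl mul1r; congr (_ + _).
  rewrite big_allpairs_dep big_seq1; apply: eq_bigr => x _.
  by rewrite pre_b_rcons// pre_a_refl mul1r.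
have fC' : class_C (size G + i).-1 f.
  have [fd fc] := fC; split.
    by move=> j ji; apply: fd; lia.
  have lt : ((size G + i).-1 < (size G + i.+1).-1)%N by have := gs_size hG; lia.
  by move=> y; apply/differentiable_continuous/derivable1_diffP; exact: fd.
have Ustep H (Hl : H \in level i.+1) : U_finite T X m prec H f /\
  calU H f = - taylor_coef R H * (calS H * EW H
    + \sum_(x <- one_ext M H) ext_sign R H x * calU (rcons H x) f).
  apply: (calU_step Hl).
  - by have [_ -> _ _] := levelP hG Hl.
  - exact: Sfin Hl.
  - by move=> K; apply: Sfin.
  - exact: Wfin Hl.
  - by move=> x xn; apply: Ufin; apply/allpairsPdep; exists H, x.
rewrite IH//; last first.
- by move=> H Hl; have [] := Ustep H Hl.
- by move=> j H ji; apply: Wfin; exact: leqW.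
- by move=> j H ji; apply: Sfin; exact: leqW.
have -> : iota 0 i.+2 = iota 0 i.+1 ++ [:: i.+1] by rewrite -(addn1 i.+1) iotaD.
rewrite big_cat big_seq1 -[RHS]addrA; congr (_ + _).
have -> : \sum_(H <- level i.+2) pre_b H G * calU H f = \sum_(H <- level i.+1)
    \sum_(x <- one_ext M H) pre_b (rcons H x) G * calU (rcons H x) f.
  by rewrite big_allpairs_dep.
rewrite -big_split; apply: eq_big_seq => H Hl; rewrite [RHS]/=.
have [_ ->] := Ustep H Hl; have [hH sH _ _] := levelP hG Hl.
rewrite [LHS]mulrA -pre_aE; last by rewrite sH; lia.
rewrite mulrDr; congr (_ + _); rewrite mulr_sumr; apply: eq_bigr => x _.
by rewrite pre_b_rcons ?mulrA// sH leq_addr.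
Qed.

End Induction.

Lemma calS_eq0 (H : pregenogram) j : genogram_spec H -> (1 < j <= size H)%N ->
  M%:Z < sid H j -> calS H = 0.
Proof.
move=> hH jH sj; rewrite /Defs.calS (@nested_sum_eq0 _ T m prec R _ _ _ _ j) ?mulr0//.
  by rewrite /= add0n; case/andP: jH => /ltnW-> ->.
by move=> jj; exact: BDset_full.
Qed.

Lemma calU_eq0 (H : pregenogram) f j : genogram_spec H -> (1 < j <= size H)%N ->
  M%:Z < sid H j -> calU H f = 0.
Proof.
move=> hH jH sj; rewrite /Defs.calU.
have [lt|ge] := ltnP j (size H).
  rewrite (@nested_sum_eq0 _ T m prec R _ _ _ _ j) ?mulr0//.
    by rewrite /= add0n; case/andP: jH => /ltnW-> _; rewrite -ltnS prednK ?gs_size.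
  by move=> jj; exact: BDset_full.
(* The last vertex has no summation index in a U-sum; its Delta is a difference at equal sets and
   vanishes. *)
have jE : j = size H by lia.
rewrite (@nested_sum_eq _ T m prec R H _ _ _ (fun=> \sum_(x <- [::] : seq unit) 0 * 0))//.
- rewrite (nested_sum_lin T m prec H _ _ _ _ (fun _ _ => 0)) big_nil mulr0//.
- by rewrite add0n leq_pred.
- exact: admissible_nil.
move=> jj sjj _; rewrite big_nil /U_args EG_rcons0 ?size_XS//; first exact: gs_size.
move=> w; rewrite /Delta uidx_nonneg//; [|lia|by rewrite -jE; lia].
by rewrite eqxx -jE BDset_full// subrr.
Qed.

(** Only nonzero terms count in the sum over the possibly infinite set [A]. The list [L] contains
    them and stays inside [A]; [insub] lifts its raw sequences to genograms without loss. *)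
Lemma fsbig_genogram (A : set genogram) (L : seq pregenogram) (F : pregenogram -> R) :
  uniq L -> (forall H, H \in L -> is_genogram H) ->
  (forall H : genogram, gseq H \in L -> A H) ->
  (forall H : genogram, A H -> F H != 0 -> gseq H \in L) ->
  \sum_(H \in A) F H = \sum_(H <- L) F H.
Proof.
move=> uL gL LA AL; pose L' : seq genogram := pmap insub L.
have memL' (H : genogram) : (H \in L') = (gseq H \in L) by rewrite mem_pmap_sub.
rewrite -(fsbig_widen [set` L'] A); first last.
- move=> H [AH /= /negP]; rewrite memL' => HL; apply/eqP.
  by apply: contraNT HL; exact: AL.
- by move=> H /=; rewrite memL'; exact: LA.
rewrite -fsbig_seq; last exact: pmap_sub_uniq.
have -> : \sum_(H <- L') F H = \sum_(H <- [seq gseq H | H <- L']) F H by rewrite big_map.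
congr (\sum_(H <- _) F H).
rewrite (@pmap_filter _ _ insub gseq); last exact: insubK.
apply/all_filterP/allP => H /gL gH /=.
by rewrite insubT.
Qed.

End Main.

Lemma gextendsP (G H : genogram) i :
  gextends H G -> gorder H = (gorder G + i)%N ->
  ((0 < i)%N -> 0 <= sid H (gorder G).+1) -> level_spec G i H.
Proof.
by move=> GH oH sH; split => //; first exact/genogramP/(gseqP H).
Qed.

Lemma coef_aE (R : realType) (H G : genogram) i :
  level_spec G i H -> coef_a R H G = pre_a R H G.
Proof.
move=> [_ sH tH _]; rewrite /coef_a; case: eqP => // HG.
have -> : gseq H = gseq G by rewrite -[RHS]tH take_oversize// -[size G]/(gorder G) -HG.
by rewrite pre_a_refl.
Qed.

Unset Implicit Arguments.
Set Strict Implicit.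
Set Printing Implicit Defensive.

Theorem theoremE3 (R : realType) (disp : measure_display)
  (Omega : measurableType disp) (P : probability Omega R)
  (d : nat) (T : {fset 'rV[int]_d}) (X : 'rV[int]_d -> {RV P >-> R})
  (m : nat) (prec : rel 'rV[int]_d)
  (T_nonempty : T != fset0)
  (var_pos : (0 < total_variance T X)%E)
  (var_fin : (total_variance T X < +oo)%E)
  (m_pos : (0 < m)%N)
  (prec_irr : irreflexive prec)
  (prec_trans : transitive prec)
  (prec_total : forall x y, x != y -> prec x y || prec y x)
  (G : genogram) (k : nat) (Gk : (gorder G <= k)%N)
  (f : R -> R) (fC : class_C k.-1 f)
  (T_fin : T_finite T X m prec G f)
  (S_fin : forall H, ext_le G k H -> S_finite T X m prec H)
  (EW_fin : forall H, ext_le G k H ->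
     finite_Ex P (fun w => derive1n (gorder H).-1 f (Wtot T X w)))
  (U_fin : forall H, ext_eq G k.+1 H -> U_finite T X m prec H f) :
  calT T X m prec G f =
    \sum_(H \in ext_le G k)
      (coef_a R H G * calS T X m prec H
       * Ex P (fun w => derive1n (gorder H).-1 f (Wtot T X w)))
    + \sum_(H \in ext_eq G k.+1) (coef_b R H G * calU T X m prec H f).
Proof.
have hG : genogram_spec G by exact/genogramP/(gseqP G).
have G0 : (0 < gorder G)%N := gs_size hG.
pose i := (k - gorder G)%N; pose M := #|` T|.
have kE : k = (gorder G + i)%N by rewrite /i; lia.
have lev_le (H : genogram) j : (j <= i)%N -> level_spec G j H -> ext_le G k H.
  move=> ji [_ sH tH dH]; split; first exact: esym tH.
    by rewrite /gorder sH kE leq_add2l.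
  by rewrite /gorder sH -{1}(addn0 (size G)) ltn_add2l.
have lev_eq (H : genogram) : level_spec G i.+1 H -> ext_eq G k.+1 H.
  move=> [_ sH tH dH]; split; first exact: esym tH.
    by rewrite /gorder sH kE addnS.
  exact: dH.
have le_lev (H : genogram) : ext_le G k H ->
    exists2 j, (j <= i)%N & level_spec G j H.
  move=> [GH Hk sH]; have GH' : (gorder G <= gorder H)%N.
    by rewrite {1}/gorder GH size_take_min geq_minr.
  exists (gorder H - gorder G)%N; first by rewrite /i leq_sub2r.
  by apply: gextendsP => //; [rewrite subnKC|rewrite subn_gt0].
have eq_lev (H : genogram) : ext_eq G k.+1 H -> level_spec G i.+1 H.
  by move=> [GH Hk sH]; apply: gextendsP => //; rewrite Hk kE addnS.
have inG (H : pregenogram) : genogram_spec H -> exists K : genogram, gseq K = H.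
  by move=> /genogramP gH; exists (Genogram gH).
(* An extension missing from the lists has an identifier above |T|, so its S- or U-term is 0. *)
have small (H : genogram) j : level_spec G j H ->
    (forall l, (1 < l <= size H)%N -> M%:Z < sid H l -> False) ->
    gseq H \in level M G j.
  move=> lH h; apply: level_complete => // l lG; rewrite leNgt; apply/negP.
  by apply: h; move: lG G0; rewrite /gorder; lia.
rewrite (@calT_levels _ _ _ P _ T X m prec G f hG i); first last.
- move=> H Hl; have lH := levelP hG Hl; have [K KE] := inG H (lv_genogram lH).
  by rewrite -KE in lH *; exact/U_fin/lev_eq.
- move=> j H ji Hl; have lH := levelP hG Hl; have [K KE] := inG H (lv_genogram lH).
  by rewrite -KE in lH *; exact/EW_fin/(lev_le _ j).
- move=> j H ji Hl; have lH := levelP hG Hl; have [K KE] := inG H (lv_genogram lH).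
  by rewrite -KE in lH *; exact/S_fin/(lev_le _ j).
- by rewrite -[size G]/(gorder G) -kE.
congr (_ + _).
  pose F (H : pregenogram) : R := pre_a R H G *
    (calS T X m prec H * Ex P (fun w => derive1n (size H).-1 f (Wtot T X w))).
  transitivity (\sum_(H <- [seq H | j <- iota 0 i.+1, H <- level M G j]) F H).
    by rewrite big_allpairs_dep.
  rewrite -(@fsbig_genogram R (ext_le G k)).
  - apply: eq_fsbigr => H; rewrite inE => /le_lev[j _ lH].
    by rewrite (coef_aE _ lH) /F mulrA.
  - apply: allpairs_uniq_dep; [exact: iota_uniq|by move=> j _; exact: level_uniq|].
    (* Members of different levels have different orders, so the flattened list has no
       repetitions. *)
    move=> [j H] [j' H'] /allpairsPdep[a [x [_ /(levelP hG)[_ sx _ _] [-> ->]]]].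
    move=> /allpairsPdep[b [y [_ /(levelP hG)[_ sy _ _] [-> ->]]]] /= xy.
    by rewrite xy in sx *; have -> : a = b by lia.
  - by move=> H /allpairsPdep[j [K [_ /(levelP hG)[/genogramP ? _ _ _] ->]]].
  - move=> H /allpairsPdep[j [K [ji /(levelP hG) lK HK]]]; rewrite -HK in lK.
    by apply: lev_le lK; move: ji; rewrite mem_iota add0n ltnS.
  - move=> H /le_lev[j ji lH] /eqP ne; apply/allpairsPdep; exists j, (gseq H).
    split => //; first by rewrite mem_iota add0n ltnS.
    apply: small => // l lH' sl; apply: ne.
    by rewrite /F (@calS_eq0 _ _ _ P _ T X m prec _ l (lv_genogram lH))// mul0r mulr0.
rewrite -(@fsbig_genogram R (ext_eq G k.+1)) //.
- exact: level_uniq.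
- by move=> H /(levelP hG)[/genogramP].
- by move=> H /(levelP hG) lH; exact: lev_eq.
move=> H /eq_lev lH /eqP ne; apply: small => // l lH' sl; apply: ne.
by rewrite (@calU_eq0 _ _ _ P _ T X m prec _ _ l (lv_genogram lH))// mulr0.
Qed.
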